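(* Let $k>1$ and let $\mathcal{L}\in\mathscr{X}_{k,d,n}$ be a linear system which contains at least one GIT semistable hypersurface. If $\mathcal{L}$ is GIT non-stable (resp. GIT unstable), then there exists a sub-linear system of $\mathcal{L}$ of dimension $k-1$ which is GIT non-stable (resp. GIT unstable).
   Context: We work over $\mathbb{C}$. Let $S_d$ be the vector space of homogeneous polynomials of degree $d$ in $x_0,\ldots,x_n$. A hypersurface of degree $d$ in $\mathbb{P}^n$ (possibly reducible or non-reduced) is an effective divisor $H_f=(f=0)$ with $0\neq f\in S_d$. A $k$-dimensional linear system of hypersurfaces of degree $d$ is a $(k+1)$-dimensional linear subspace $\mathcal{L}\subset S_d$; $H_f\in\mathcal{L}$ means $f\in\mathcal{L}$; a sub-linear system of dimension $k-1$ is a $k$-dimensional linear subspace of $\mathcal{L}$. The space $\mathscr{X}_{k,d,n}$ of all $k$-dimensional linear systems is the Grassmannian of $(k+1)$-dimensional subspaces of $S_d$, embedded in $\mathbb{P}(\Lambda^{k+1}S_d)$ by Plücker coordinates. The group $SL_{n+1}(\mathbb{C})$ acts by linear changes of coordinates on $S_d$ and on its exterior powers. For such a representation $W$, a point $[v]\in\mathbb{P}(W)$ is GIT semistable if $0\notin\overline{SL_{n+1}\cdot v}$, GIT unstable otherwise, GIT stable if it is semistable, $SL_{n+1}\cdot v$ is closed in $W$ and $v$ has finite stabilizer, and GIT non-stable if it is not stable. For a hypersurface $H_f$ these notions are applied to $[f]\in\mathbb{P}(S_d)$; for a linear system of dimension $j$ they are applied to its Plücker point in $\mathbb{P}(\Lambda^{j+1}S_d)$.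 *)

(* Defs.v *)
From HB Require Import structures.
From mathcomp Require Import all_boot all_order all_algebra.
From mathcomp Require Import boolp classical_sets cardinality reals.
From mathcomp Require Import complex mpoly.

Set Implicit Arguments.
Unset Strict Implicit.
Unset Printing Implicit Defensive.

Import GRing.Theory.
Local Open Scope ring_scope.

(* Closures and closed sets are taken in the Zariski topology, as is usual in
   GIT; for orbits of SL_(n+1)(C) the Euclidean topology gives the same
   notions. *)
Section Zariski.
Variables (F : fieldType) (W : vectType F).

Definition polyfun (p : {mpoly F[\dim {:W}]}) (w : W) : F :=
  p.@[fun i => coord (vbasis {:W}) i w].

Definition zariski_closure (A : set W) : set W :=
  fun w => forall p, (forall a, A a -> polyfun p a = 0) -> polyfun p w = 0.

Definition zariski_closed (A : set W) : Prop :=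
  forall w, zariski_closure A w -> A w.

End Zariski.

Definition SL (F : fieldType) (m : nat) : set 'M[F]_m := fun g => \det g = 1.

(* The point [v] of P(W) is given by a representative v != 0; all notions are
   invariant under rescaling v. The zero vector is never semistable. *)
Section GIT.
Variables (F : fieldType) (m : nat) (W : vectType F) (act : 'M[F]_m -> W -> W).

Definition SLorbit (v : W) : set W :=
  fun w => exists2 g, SL g & w = act g v.

Definition SLstabilizer (v : W) : set 'M[F]_m :=
  fun g => SL g /\ act g v = v.

Definition git_semistable (v : W) : Prop :=
  ~ zariski_closure (SLorbit v) 0.

Definition git_unstable (v : W) : Prop := ~ git_semistable v.

Definition git_stable (v : W) : Prop :=
  [/\ git_semistable v, zariski_closed (SLorbit v)
    & finite_set (SLstabilizer v)].

Definition git_nonstable (v : W) : Prop := ~ git_stable v.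

End GIT.

(* The exterior power of V in Plucker coordinates: its standard basis
   e_(t_0) /\ ... /\ e_(t_(m-1)), for e := vbasis {:V}, is indexed by the
   strictly increasing m-tuples t. *)
Section ExteriorPower.
Variables (F : fieldType) (V : vectType F) (m : nat).

Definition increasing_tuple (N : nat) :=
  {t : m.-tuple 'I_N | sorted ltn (map val t)}.

Definition extpow : vectType F := {ffun increasing_tuple (\dim {:V}) -> F^o}.

Definition wedge (v : m.-tuple V) : extpow :=
  [ffun t : increasing_tuple (\dim {:V}) =>
    \det (\matrix_(i < m, j < m)
            coord (vbasis {:V}) (tnth (val t) j) (tnth v i))].

(* The linear map e_(t_0) /\ ... |-> phi e_(t_0) /\ ... induced by phi. *)
Definition extpow_map (phi : V -> V) (w : extpow) : extpow :=
  \sum_(t : increasing_tuple (\dim {:V}))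
    w t *: wedge [tuple phi (tnth (vbasis {:V}) (tnth (val t) i)) | i < m].

End ExteriorPower.

Section Forms.
Variables (F : fieldType) (n d : nat).

Definition forms : vectType F := dhomog n.+1 F d.

Definition linear_change (g : 'M[F]_n.+1) : n.+1.-tuple {mpoly F[n.+1]} :=
  [tuple \sum_(i < n.+1) g i j *: 'X_i | j < n.+1].

Fact linear_change_homog (g : 'M[F]_n.+1) (f : dhomog n.+1 F d) :
  (f : {mpoly F[n.+1]}) \mPo linear_change g \is d.-homog.
Proof.
case: f => f /= /dhomogP fd; rewrite comp_mpolyE big_seq.
apply: rpred_sum => u /fd <-; apply: rpredZ; rewrite /= mdegE.
elim/big_ind2: _ => [|p e q e' hp hq|i _]; first exact: dhomog1.
  exact: dhomogM.
have hi : tnth (linear_change g) i \is 1.-homog.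
  rewrite tnth_mktuple; apply: rpred_sum => j _; apply: rpredZ.
  by rewrite dhomogX /= mdeg1.
by have := dhomogMn (u i) hi; rewrite mul1n.
Qed.

(* (g . f)(x) = f(x g) for the row vector x = (x_0, ..., x_n); this is a left
   action, with the same orbits as f |-> f(g^-1 x). *)
Definition form_act (g : 'M[F]_n.+1) (f : forms) : forms :=
  DHomog (linear_change_homog g f).

(* A j-dimensional linear system is a subspace L with \dim L = j.+1. *)
Definition plucker (L : {vspace forms}) : extpow forms (\dim L) :=
  wedge (vbasis L).

Definition plucker_act (m : nat) (g : 'M[F]_n.+1) :
  extpow forms m -> extpow forms m := extpow_map (form_act g).

Definition hypersurface_semistable (f : forms) : Prop :=
  git_semistable form_act f.

Definition system_unstable (L : {vspace forms}) : Prop :=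
  git_unstable (@plucker_act (\dim L)) (plucker L).

Definition system_nonstable (L : {vspace forms}) : Prop :=
  git_nonstable (@plucker_act (\dim L)) (plucker L).

End Forms.

(* Main.v *)
Require Import Defs.
From HB Require Import structures.
From mathcomp Require Import all_boot all_order all_algebra.
From mathcomp Require Import perm ring boolp classical_sets cardinality.
From mathcomp Require Import reals complex mpoly.

Set Implicit Arguments.
Unset Strict Implicit.
Unset Printing Implicit Defensive.

Import Order.TTheory GRing.Theory Num.Theory.
Local Open Scope ring_scope.

(** If a one-parameter subgroup destabilizes L, order a basis f_0, ..., f_k of
    L adapted to the weight filtration by increasing weights w_0 <= ... <= w_k.
    Instability reads w_0 + ... + w_k > 0, whereas a semistable member of L
    forces w_0 <= 0; hence w_1 + ... + w_k > 0, and the span of f_1, ..., f_k is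
    destabilized by the same subgroup. Non-stability is the same with >= 0.

    Instead of one-parameter subgroups, the proof uses diagonal matrices over a
    large valuation ring, whose weights live in its value group. A place on a
    set T (record [place]) assigns to some functions T -> F a limit in F,
    compatibly with sums and products, in such a way that f or 1/f always has a
    limit; the functions with a limit are called bounded. Places exist by
    Zorn's lemma ([place_exists]), and they turn the hypotheses on L into a
    matrix g of functions, with determinant 1, that moves the Pluecker point of
    L to a bounded one (one of limit 0 if L is unstable). If w is in the
    closure of an orbit, some place makes the orbit tend to w
    ([place_of_closure]); if the stabilizer of L is infinite, some place makes
    one of its matrix entries unbounded ([place_of_infinite]).

    The Cartan decomposition ([cartan]) writes l g = diag(a) q with a torus
    point a and matrices l and q that have limits of determinant 1; it remains
    to study diag(a) q L, where q may be replaced by its limit. The weight of a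
    monomial is replaced by the size of its value at a, small values standing
    for large weights, and an adapted basis comes from a choice of monomials at
    which the Pluecker coordinate is nonzero and the value of a is largest
    ([exists_hyperplane]). The resulting hyperplane L' has a bounded (null)
    Pluecker point diag(a) q L'. When this tends to 0, L' is unstable
    ([unstable_of_lim0]). When it is only bounded and a is not, suppose that L'
    is stable: the limit is in the orbit of L', and it is fixed by a
    one-parameter subgroup orthogonal to the weights at which a has a nonzero
    finite limit ([unit_char_orthogonal]), so that the stabilizer of L' is
    infinite, a contradiction ([nonstable_of_bounded]). *)

(** * Places on a set of parameters *)

Section Subalgebra.
Variables (T : Type) (F : fieldType).
Implicit Types (f g u : T -> F) (A : set ((T -> F) * F)).

(** A partial homomorphism from the ring of functions on T to F is given by
    its graph, so that extending it is enlarging a set; it is single-valued as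
    soon as the graph does not contain (0, 1). *)
Record subalgebra A : Prop := Subalgebra {
  sub_cst : forall c, A (fun=> c, c);
  subD : forall f g a b, A (f, a) -> A (g, b) -> A (fun t => f t + g t, a + b);
  subM : forall f g a b, A (f, a) -> A (g, b) -> A (fun t => f t * g t, a * b) }.

Lemma sub_sum A (I : Type) (r : seq I) (f : I -> T -> F) (a : I -> F) :
  subalgebra A -> (forall i, A (f i, a i)) ->
  A (fun t => \sum_(i <- r) f i t, \sum_(i <- r) a i).
Proof.
move=> sA Afa; elim: r => [|i r IH].
  by rewrite big_nil; under eq_fun do rewrite big_nil; exact: sub_cst.
by rewrite big_cons; under eq_fun do rewrite big_cons; exact: subD.
Qed.

Lemma sub_prod A (I : Type) (r : seq I) (f : I -> T -> F) (a : I -> F) :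
  subalgebra A -> (forall i, A (f i, a i)) ->
  A (fun t => \prod_(i <- r) f i t, \prod_(i <- r) a i).
Proof.
move=> sA Afa; elim: r => [|i r IH].
  by rewrite big_nil; under eq_fun do rewrite big_nil; exact: sub_cst.
by rewrite big_cons; under eq_fun do rewrite big_cons; exact: subM.
Qed.

Lemma sub_det A m (M : T -> 'M[F]_m) (N : 'M[F]_m) : subalgebra A ->
  (forall i j, A (fun t => M t i j, N i j)) -> A (fun t => \det (M t), \det N).
Proof.
move=> sA AM; rewrite /determinant; apply: sub_sum => // s.
by apply: subM => //; [exact: sub_cst | apply: sub_prod].
Qed.

End Subalgebra.

(** A place in the sense of valuation theory, the field being replaced by the
    ring of all functions T -> F. By [lim_split] the sets P such that all
    functions vanishing on P have the limit 0 form an ultrafilter, modulo which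
    the functions form a field, and by [lim_total] those with a limit form a valuation ring of this field.
    Working with functions makes each identity between matrices over the field
    a pointwise identity over F. *)
Record place (T : Type) (F : fieldType) := Place {
  lim :> (T -> F) * F -> Prop;
  place_sub : subalgebra lim;
  lim_neq01 : ~ lim (fun=> 0, 1);
  lim_split : forall P : T -> Prop,
    (forall f, (forall t, P t -> f t = 0) -> lim (f, 0)) \/
    (forall f, (forall t, ~ P t -> f t = 0) -> lim (f, 0));
  lim_total : forall f, (exists c, lim (f, c)) \/ lim (fun t => (f t)^-1, 0) }.

Section PlaceExists.
Variables (T : Type) (F : closedFieldType).
Implicit Types (f g u : T -> F) (A : set ((T -> F) * F)).

Lemma maximal_subalgebra A : subalgebra A -> ~ A (fun=> 0, 1) ->
  exists M, [/\ subalgebra M, ~ M (fun=> 0, 1), (A `<=` M)%classic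
    & forall B, subalgebra B -> (M `<=` B)%classic -> ~ B (fun=> 0, 1) ->
      (B `<=` M)%classic].
Proof.
move=> sA A01.
pose good B := [/\ subalgebra B, ~ B (fun=> 0, 1) & (A `<=` B)%classic].
have gA : good A by split.
(* set0 is admitted as a bound of the empty chain *)
have [//| M [MP Mmax]] := @Zorn_bigcup _ (fun B => B = set0 \/ good B).
  move=> C Cgood Ctot.
  have [[X [CX gX]]|noX] := pselect (exists X, C X /\ good X); last first.
    left; apply/seteqP; split=> // x [X CX Xx].
    have [X0|gX] := Cgood _ CX; last by case: noX; exists X.
    by rewrite X0 in Xx.
  right.
  have in2 x y : (\bigcup_(X in C) X)%classic x -> (\bigcup_(X in C) X)%classic y ->
      exists Y, [/\ C Y, good Y, Y x & Y y].
    move=> [Y CY Yx] [Z CZ Zy].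
    have ne (W : set ((T -> F) * F)) w : C W -> W w -> good W.
      by move=> CW Ww; have [W0|//] := Cgood _ CW; rewrite W0 in Ww.
    have [YZ|ZY] := Ctot _ _ CY CZ.
      by exists Z; split=> //; [exact: ne Zy|exact: YZ].
    by exists Y; split=> //; [exact: ne Yx|exact: ZY].
  have [sX X01 AX] := gX.
  split; first split.
  - by move=> c; exists X => //; exact: sub_cst.
  - move=> f g a b fa gb; have [Y [CY [sY _ _] Yf Yg]] := in2 _ _ fa gb.
    by exists Y => //; exact: subD.
  - move=> f g a b fa gb; have [Y [CY [sY _ _] Yf Yg]] := in2 _ _ fa gb.
    by exists Y => //; exact: subM.
  - by move=> h; have [Y [_ [_ Y01 _] /Y01]] := in2 _ _ h h.
  - by move=> x /AX Xx; exists X.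
have [sM M01 AM] : good M.
  case: MP => // M0; case: (Mmax A); last by right.
  rewrite M0; split; first exact: sub0set.
  by move=> /(_ (fun=> 0, 0)) H; apply: H; exact: sub_cst.
exists M; split=> // B sB MB B01.
apply: contrapT => nBM; case: (Mmax B); first by split.
by right; split=> // x /AM /MB.
Qed.

Section Maximal.
Variables (M : set ((T -> F) * F)).
Hypotheses (sM : subalgebra M) (M01 : ~ M (fun=> 0, 1)).
Hypothesis Mmax : forall B, subalgebra B -> (M `<=` B)%classic ->
  ~ B (fun=> 0, 1) -> (B `<=` M)%classic.

(** Otherwise there would be f and g with limit 1 that vanish respectively on P
    and off P; but their product is 0. *)
Lemma maximal_split (P : T -> Prop) :
  (forall f, (forall t, P t -> f t = 0) -> M (f, 0)) \/
  (forall f, (forall t, ~ P t -> f t = 0) -> M (f, 0)).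
Proof.
have step (Q : T -> Prop) : (forall f, (forall t, Q t -> f t = 0) -> M (f, 0)) \/
    exists2 f, M (f, 1) & forall t, Q t -> f t = 0.
  pose B : set ((T -> F) * F) := fun x =>
    exists2 g, M (g, x.2) & forall t, Q t -> x.1 t = g t.
  have sB : subalgebra B.
    split=> [c|f g a b|f g a b].
    - by exists (fun=> c) => //; exact: sub_cst.
    - move=> [f' Mf ff'] [g' Mg gg']; exists (fun t => f' t + g' t).
        exact: subD.
      by move=> t Qt /=; move: (ff' t Qt) (gg' t Qt) => /= -> ->.
    - move=> [f' Mf ff'] [g' Mg gg']; exists (fun t => f' t * g' t).
        exact: subM.
      by move=> t Qt /=; move: (ff' t Qt) (gg' t Qt) => /= -> ->.
  have MB : (M `<=` B)%classic by case=> f a Mf; exists f.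
  have [[g Mg g0]|B01] := pselect (B (fun=> 0, 1)).
    by right; exists g => // t Qt; rewrite -g0.
  left=> f f0; apply: (Mmax sB MB B01); exists (fun=> 0) => //.
  exact: sub_cst.
have [|[f Mf f0]] := step P; first by left.
have [|[g Mg g0]] := step (fun t => ~ P t); first by right.
case: M01; have := subM sM Mf Mg; rewrite mulr1.
congr (M (_, _)); apply: funext => t.
by have [Pt|nPt] := pselect (P t); [rewrite f0 ?mul0r | rewrite g0 ?mulr0].
Qed.

(** Polynomials with coefficients in the ring of M, together with their
    reduction; the uniform bound on their size allows expanding values. *)
Definition lim_poly n (p : T -> {poly F}) (q : {poly F}) :=
  (forall t, size (p t) <= n)%N /\ forall i, M (fun t => (p t)`_i, q`_i).

Lemma lim_polyC (q : {poly F}) : lim_poly (size q) (fun=> q) q.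
Proof. by split=> // i; exact: sub_cst. Qed.

Lemma lim_polyD n m p q p' q' : lim_poly n p q -> lim_poly m p' q' ->
  lim_poly (maxn n m) (fun t => p t + p' t) (q + q').
Proof.
move=> [sp pq] [sp' pq']; split=> [t|i].
  rewrite (leq_trans (size_polyD _ _)) // geq_max !leq_max.
  by rewrite sp sp' orbT.
by rewrite coefD; under eq_fun do rewrite coefD; exact: subD.
Qed.

Lemma lim_polyM n m p q p' q' : lim_poly n p q -> lim_poly m p' q' ->
  lim_poly (n + m) (fun t => p t * p' t) (q * q').
Proof.
move=> [sp pq] [sp' pq']; split=> [t|i].
  rewrite (leq_trans (size_polyMleq _ _)) // (leq_trans (leq_pred _)) //.
  by rewrite leq_add.
rewrite coefM; under eq_fun do rewrite coefM.
by apply: sub_sum => // j; exact: subM.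
Qed.

(** By maximality, only a relation satisfied by f whose reduction does not
    vanish at c prevents f from having the limit c. *)
Lemma maximal_adjoin f c : M (f, c) \/ exists n p q,
  [/\ lim_poly n p q, forall t, (p t).[f t] = 0 & q.[c] = 1].
Proof.
pose B : set ((T -> F) * F) := fun x => exists n p q,
  [/\ lim_poly n p q, forall t, (p t).[f t] = x.1 t & q.[c] = x.2].
have sB : subalgebra B.
  split=> [a|g g' a a'|g g' a a'].
  - exists (size a%:P), (fun=> a%:P), a%:P; split; first exact: lim_polyC.
      by move=> t; rewrite hornerC.
    by rewrite hornerC.
  - move=> [n [p [q [pq pg qa]]]] [n' [p' [q' [pq' pg' qa']]]].
    exists (maxn n n'), (fun t => p t + p' t), (q + q').
    split; first exact: lim_polyD.
      by move=> t; rewrite hornerD pg pg'.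
    by rewrite hornerD qa qa'.
  - move=> [n [p [q [pq pg qa]]]] [n' [p' [q' [pq' pg' qa']]]].
    exists (n + n')%N, (fun t => p t * p' t), (q * q').
    split; first exact: lim_polyM.
      by move=> t; rewrite hornerM pg pg'.
    by rewrite hornerM qa qa'.
have MB : (M `<=` B)%classic.
  case=> g a Mg; exists 1, (fun t => (g t)%:P), a%:P; split.
  - split=> [t|i]; first exact: size_polyC_leq1.
    rewrite coefC; under eq_fun do rewrite coefC.
    by case: (i == 0); last exact: sub_cst.
  - by move=> t; rewrite hornerC.
  - by rewrite hornerC.
have [|B01] := pselect (B (fun=> 0, 1)); first by right.
left; apply: (Mmax sB MB B01); exists 2, (fun=> 'X), 'X; split.
- by split=> [t|i]; [rewrite size_polyX | exact: sub_cst].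
- by move=> t; rewrite hornerX.
- by rewrite hornerX.
Qed.

(** The reductions of the relations satisfied by f form an ideal of F[X]. A
    common root of the ideal is a possible limit of f; without one the ideal
    contains 1, as F is algebraically closed. *)
Lemma maximal_relation f : (exists c, M (f, c)) \/
  exists n p, lim_poly n p 1 /\ forall t, (p t).[f t] = 0.
Proof.
have [|nf] := pselect (exists c, M (f, c)); [by left|right].
pose J q := exists n p, lim_poly n p q /\ forall t, (p t).[f t] = 0.
have JM r q : J q -> J (r * q).
  move=> [n [p [pq p0]]]; exists (size r + n)%N, (fun t => r * p t); split.
    exact: lim_polyM (lim_polyC r) pq.
  by move=> t; rewrite hornerM p0 mulr0.
have JD q q' : J q -> J q' -> J (q + q').
  move=> [n [p [pq p0]]] [n' [p' [pq' p0']]]; exists (maxn n n'), (fun t => p t + p' t); split.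
    exact: lim_polyD pq pq'.
  by move=> t; rewrite hornerD p0 p0' addr0.
have Jc c : exists2 q, J q & q.[c] = 1.
  have [Mf|[n [p [q [pq p0 q1]]]]] := maximal_adjoin f c.
    by case: nf; exists c.
  by exists q => //; exists n, p.
suff H (n : nat) (q : {poly F}) : (size q <= n)%N -> q != 0 -> J q -> J 1.
  have [q Jq q1] := Jc 0; apply: (H (size q) q) => //.
  by apply/eqP=> q0; move: q1; rewrite q0 horner0; apply/eqP; rewrite eq_sym oner_eq0.
elim: n q => [|n IH] q sq q0 Jq; first by rewrite leqn0 size_poly_eq0 (negPf q0) in sq.
have [/eqP/size_poly1P[c c0 qc]|sq1] := eqVneq (size q) 1.
  have := JM c^-1%:P _ Jq; rewrite qc -polyCM mulVf //.
have /closed_rootP [c /rootP qc] : size q != 1 by [].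
have [r Jr rc] := Jc c.
have Jr' : J (r %% q).
  have -> : r %% q = r + (- (r %/ q)) * q.
    by rewrite {2}(divp_eq r q) mulNr addrC addKr.
  by apply: JD => //; exact: JM.
apply: (IH (r %% q)) => //.
  by rewrite -ltnS (leq_trans _ sq) // ltn_modp.
apply/eqP => r0; have : (r %% q).[c] = 1.
  by rewrite -rc {2}(divp_eq r q) hornerD hornerM qc mulr0 add0r.
by rewrite r0 horner0 => /eqP; rewrite eq_sym oner_eq0.
Qed.

(** Suppose that f has no limit and that 1/f cannot have the limit 0. The
    relation that prevents the latter makes f integral, so that the powers of f
    generate a finite module over the ring of M; the relation of
    [maximal_relation] says that this module is equal to its product with the
    ideal of functions of limit 0. This contradicts Nakayama's lemma, here in
    the form of a determinant that vanishes and has limit 1. *)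
Lemma maximal_total f : (exists c, M (f, c)) \/ M (fun t => (f t)^-1, 0).
Proof.
have [|[n [p [[sp pM] p0]]]] := maximal_relation f; first by left.
have [f0|f0] := maximal_split (fun t => f t <> 0); last first.
  by left; exists 0; apply: f0 => t /contrapT.
have [|[m [r [q [[sr rM] r0 q1]]]]] := maximal_adjoin (fun t => (f t)^-1) 0.
  by right.
exfalso; apply: M01.
have q01 : q`_0 = 1 by rewrite -q1 horner_coef0.
pose c t := (r t)`_0.
have Mc : M (c, 1) by rewrite -q01; exact: rM.
(* an integral equation for f away from its zeros; the coefficient c of its
   leading term has limit 1 *)
have int t : f t <> 0 -> c t * f t ^+ m = - \sum_(i < m) (r t)`_i.+1 * f t ^+ (m - i.+1).
  move=> /eqP ft0; have := r0 t; rewrite (@horner_coef_wide _ m.+1); last exact: leqW.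
  move=> /(congr1 (fun x => x * f t ^+ m)); rewrite mul0r mulr_suml big_ord_recl /=.
  rewrite expr0 mulr1 => /(canRL (addrK _)); rewrite sub0r => ->.
  congr (- _); apply: eq_bigr => i _; rewrite -mulrA; congr (_ * _).
  have im : (i < m)%N by [].
  rewrite /bump /= add1n exprVn.
  have -> : f t ^+ m = f t ^+ i.+1 * f t ^+ (m - i.+1) by rewrite -exprD subnKC.
  by rewrite mulKf // expf_neq0.
have MX g a k : M (g, a) -> M (fun t => g t ^+ k, a ^+ k).
  move=> Mg; elim: k => [|k IH].
    by rewrite expr0; under eq_fun do rewrite expr0; exact: sub_cst.
  by rewrite exprS; under eq_fun do rewrite exprS; exact: subM.
(* S is the product of the module generated by the powers of f with the ideal
   of functions of limit 0; multiplication by c f preserves it *)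
pose S x := exists s : nat -> T -> F, (forall j, M (s j, 0)) /\
  forall t, f t <> 0 -> x t = \sum_(j < m) s j t * f t ^+ j.
have SD x y : S x -> S y -> S (fun t => x t + y t).
  move=> [s [Ms xs]] [s' [Ms' ys]]; exists (fun j t => s j t + s' j t); split.
    by move=> j; rewrite -[0]addr0; exact: subD.
  move=> t ft; rewrite xs // ys // -big_split /=.
  by apply: eq_bigr => j _; rewrite mulrDl.
have S0 : S (fun=> 0).
  exists (fun _ _ => 0); split; first by move=> j; exact: sub_cst.
  by move=> t _; rewrite big1 // => j _; rewrite mul0r.
have Ssum k (x : nat -> T -> F) : (forall i, (i < k)%N -> S (x i)) ->
    S (fun t => \sum_(i < k) x i t).
  elim: k => [|k IH] Sx.
    by under eq_fun do rewrite big_ord0.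
  under eq_fun do rewrite big_ord_recr /=.
  by apply: SD; [apply: IH => i ik; exact/Sx/leqW | exact: Sx].
have Smon g j : (j < m)%N -> M (g, 0) -> S (fun t => g t * f t ^+ j).
  move=> jm Mg; exists (fun i t => if i == j then g t else 0); split.
    by move=> i; case: (i == j) => //; exact: sub_cst.
  move=> t _ /=; rewrite (bigD1 (Ordinal jm)) //= eqxx big1 ?addr0 // => i /negPf.
  by rewrite -val_eqE /= => ->; rewrite mul0r.
have Seq x y : S x -> (forall t, f t <> 0 -> y t = x t) -> S y.
  by move=> [s [Ms xs]] xy; exists s; split=> // t ft; rewrite xy // xs.
have Scf x : S x -> S (fun t => c t * f t * x t).
  move=> [s [Ms xs]].
  have Sj j : (j < m)%N -> S (fun t => c t * f t * (s j t * f t ^+ j)).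
    rewrite leq_eqVlt => /orP[/eqP jm|jm]; last first.
      apply: (@Seq (fun t => (c t * s j t) * f t ^+ j.+1)).
        by apply: Smon => //; rewrite -(mulr0 1); exact: subM.
      by move=> t _; rewrite exprS mulrACA.
    apply: (@Seq (fun t => \sum_(i < m) (- s j t * (r t)`_i.+1) * f t ^+ (m - i.+1))).
      apply: (Ssum m (fun i t => (- s j t * (r t)`_i.+1) * f t ^+ (m - i.+1))).
      move=> i im; apply: Smon; first by rewrite ltn_subrL /= (leq_ltn_trans _ im).
      rewrite -[X in M (_, X)](mul0r q`_i.+1); apply: subM => //.
      rewrite -[X in M (_, X)](mulr0 (-1)); under eq_fun do rewrite -mulN1r.
      by apply: subM => //; exact: sub_cst.
    move=> t ft; rewrite mulrACA -exprS jm mulrAC int // mulNr mulr_suml.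
    rewrite -sumrN; apply: eq_bigr => i _.
    by ring.
  apply: (Seq _ _ (Ssum _ _ Sj)) => t ft.
  by rewrite xs // mulr_sumr.
have Scfn x k : S x -> S (fun t => (c t * f t) ^+ k * x t).
  move=> Sx; elim: k => [|k IH]; first by apply: (Seq _ _ Sx) => t _; rewrite expr0 mul1r.
  by apply: (Seq _ _ (Scf _ IH)) => t _; rewrite exprS !mulrA.
have n0 : (0 < n)%N.
  case: n sp => // sp; have := pM 0; rewrite coef1 /=.
  suff -> : (fun t => (p t)`_0) = (fun=> 0) by [].
  by apply: funext => t; have := sp t; rewrite leqn0 size_poly_eq0 => /eqP ->; rewrite coef0.
(* the factor c^n provides a factor c for each power of f in the relation p *)
pose b t := c t ^+ n * (p t)`_0.
have Mb : M (b, 1).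
  rewrite -(mulr1 1) -{1}(expr1n F n); apply: subM => //; first exact: MX.
  by have := pM 0; rewrite coef1.
have Sb j : (j < m)%N -> S (fun t => b t * f t ^+ j).
  move=> jm.
  pose x i t := (c t * f t) ^+ i.+1 * ((- c t ^+ (n - i.+1) * (p t)`_i.+1) * f t ^+ j).
  have Sx i : S (x i).
    apply: Scfn; apply: Smon => //; rewrite -[X in M (_, X)](mulr0 (- 1)); apply: subM => //.
      under eq_fun do rewrite -mulN1r; rewrite -[X in M (_, X)](mulr1 (-1)); apply: subM => //.
        exact: sub_cst.
      by rewrite -(expr1n F (n - i.+1)); exact: MX.
    by have := pM i.+1; rewrite coef1.
  apply: (Seq _ _ (Ssum n.-1 x (fun i _ => Sx i))) => t ft.
  have spt : (size (p t) <= n.-1.+1)%N by rewrite prednK.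
  have := p0 t; rewrite (horner_coef_wide _ spt) big_ord_recl /=.
  rewrite expr0 mulr1 => /(canRL (addrK _)); rewrite sub0r /b => ->.
  rewrite mulrN -mulNr mulr_sumr mulr_suml; apply: eq_bigr => i _.
  rewrite /bump /= add1n /x exprMn.
  have -> : c t ^+ n = c t ^+ i.+1 * c t ^+ (n - i.+1).
    by rewrite -exprD subnKC // (leq_trans (ltn_ord i)) // leq_pred.
  by ring.
have absurd g : M (g, 1) -> (forall t, f t <> 0 -> g t = 0) -> M (fun=> 0, 1).
  move=> Mg g0; have := subD sM Mg (subM sM (sub_cst sM (-1)) (f0 _ g0)).
  rewrite mulr0 addr0; congr (M (_, _)); apply: funext => t /=.
  by rewrite mulN1r subrr.
have [m0|m0] := posnP m.
  apply: absurd Mc _ => t /int.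
  by rewrite m0 expr0 mulr1 big_ord0 oppr0.
(* the system (b - s) (1, f, ..., f^(m-1)) = 0 has a determinant of limit 1 *)
have [s Ms] := boolp.choice (fun j : 'I_m => Sb j (ltn_ord j)).
pose D t := \matrix_(i < m, j < m) (b t *+ (i == j) - s j i t).
have MD : M (fun t => \det (D t), 1).
  rewrite -(det1 F m); apply: sub_det => // i j.
  under eq_fun do rewrite mxE -mulN1r; rewrite !mxE -[_%:R]addr0 -(mulr0 (-1)).
  apply: subD => //; last by apply: subM => //; [exact: sub_cst | exact: (Ms j).1].
  by case: (i == j); last exact: sub_cst.
apply: absurd MD _ => t ft; apply/eqP/det0P.
exists (\row_(i < m) f t ^+ i).
  apply/eqP => /rowP /(_ (Ordinal m0)); rewrite !mxE expr0; apply/eqP.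
  exact: oner_neq0.
apply/rowP => j; rewrite !mxE.
under eq_bigr do rewrite !mxE mulrBr.
rewrite big_split /= sumrN (bigD1 j) //= eqxx big1 ?addr0 => [|i /negPf ->]; last first.
  by rewrite mulr0n mulr0.
rewrite mulr1n mulrC ((Ms j).2 t ft); apply/eqP; rewrite subr_eq0; apply/eqP.
by apply: eq_bigr => i _; rewrite mulrC.
Qed.

End Maximal.

Theorem place_exists A : subalgebra A -> ~ A (fun=> 0, 1) ->
  exists p : place T F, (A `<=` p)%classic.
Proof.
move=> sA A01; have [M [sM M01 AM Mmax]] := maximal_subalgebra sA A01.
pose p := @Place T F M sM M01
  (maximal_split sM M01 Mmax) (maximal_total sM M01 Mmax).
by exists p.
Qed.

End PlaceExists.

(** * Calculus in the valuation ring of a place *)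

Lemma exists_min (I : finType) (R : I -> I -> Prop) (P : I -> Prop) :
  (forall i j, R i j \/ R j i) -> (forall i j k, R i j -> R j k -> R i k) ->
  (exists i, P i) -> exists2 i, P i & forall j, P j -> R i j.
Proof.
move=> tot tr [i0 Pi0].
suff H (s : seq I) : exists2 i, P i & forall j, j \in s -> P j -> R i j.
  have [i Pi Ri] := H (enum I); exists i => // j; apply: Ri; exact: mem_enum.
elim: s => [|j s [i Pi Ri]]; first by exists i0.
have [Pj|nPj] := pselect (P j); last first.
  by exists i => // l; rewrite inE => /orP[/eqP->//|/Ri].
have [Rij|Rji] := tot i j.
  by exists i => // l; rewrite inE => /orP[/eqP->//|/Ri].
exists j => // l; rewrite inE => /orP[/eqP-> _|ls Pl].
  by case: (tot j j).
by apply: tr Rji _; exact: Ri.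
Qed.

Section PlaceTheory.
Variables (T : Type) (F : fieldType) (p : place T F).
Implicit Types (f g : T -> F) (P Q : T -> Prop).

Let sp := place_sub p.

(** Equivalently, P holds on a set of the ultrafilter of p. *)
Definition ae P := forall f, (forall t, P t -> f t = 0) -> p (f, 0).

Lemma limN f a : p (f, a) -> p (fun t => - f t, - a).
Proof.
move=> pf; under eq_fun do rewrite -mulN1r.
by rewrite -[X in p (_, X)]mulN1r; apply: (subM sp) => //; exact: (sub_cst sp).
Qed.

Lemma lim_uniq f a b : p (f, a) -> p (f, b) -> a = b.
Proof.
move=> fa fb; apply/eqP; rewrite -subr_eq0; apply: contrapT => /negP ab.
have := subM sp (sub_cst sp (a - b)^-1) (subD sp fa (limN fb)).
rewrite mulVf //; under eq_fun do rewrite subrr mulr0.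
exact: lim_neq01.
Qed.

Lemma aeW P Q : (forall t, P t -> Q t) -> ae P -> ae Q.
Proof. by move=> PQ aP f Qf; apply: aP => t /PQ /Qf. Qed.

Lemma aeT P : (forall t, P t) -> ae P.
Proof.
move=> aP f f0; have -> : f = fun=> 0 by apply: funext => t; exact: f0.
exact: (sub_cst sp).
Qed.

Lemma lim_ae P f g a : ae P -> (forall t, P t -> f t = g t) -> p (f, a) -> p (g, a).
Proof.
move=> aP fg pf.
have : p (fun t => g t - f t, 0) by apply: aP => t /fg ->; rewrite subrr.
move=> /(subD sp pf); rewrite addr0.
by under eq_fun do rewrite subrKC.
Qed.

Lemma aeI P Q : ae P -> ae Q -> ae (fun t => P t /\ Q t).
Proof.
move=> aP aQ f f0.
pose g t := if pselect (P t) then 0 else f t.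
have pg : p (g, 0) by apply: aP => t Pt; rewrite /g; case: pselect.
apply: (lim_ae aQ _ pg) => t Qt; rewrite /g; case: pselect => // Pt.
by rewrite f0.
Qed.

Lemma ae_forall (I : finType) (P : I -> T -> Prop) :
  (forall i, ae (P i)) -> ae (fun t => forall i, P i t).
Proof.
move=> aP.
have H (s : seq I) : ae (fun t => forall i, i \in s -> P i t).
  elim: s => [|i s IH]; first exact: aeT.
  apply: aeW (aeI (aP i) IH) => t [Pi Ps] j.
  by rewrite inE => /orP[/eqP->|/Ps].
by apply: aeW (H (enum I)) => t Pt i; apply: Pt; exact: mem_enum.
Qed.

Lemma ae_split P : ae P \/ ae (fun t => ~ P t).
Proof. exact: lim_split. Qed.

Lemma ae_neq0 f c : p (f, c) -> c != 0 -> ae (fun t => f t != 0).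
Proof.
move=> pf c0; have [//|anf] := ae_split (fun t => f t != 0).
case/eqP: c0; apply: lim_uniq pf _.
by apply: anf => t /negP; rewrite negbK => /eqP.
Qed.

Lemma limV f c : p (f, c) -> c != 0 -> p (fun t => (f t)^-1, c^-1).
Proof.
move=> pf c0; have [[d pd]|] := lim_total p (fun t => (f t)^-1); last first.
  under eq_fun do rewrite invrK.
  by move=> pf0; rewrite (lim_uniq pf pf0) eqxx in c0.
suff -> : c^-1 = d by [].
apply: (mulfI c0); rewrite divff //.
have p1 : p (fun t => f t * (f t)^-1, 1).
  apply: (lim_ae (ae_neq0 pf c0) _ (sub_cst sp 1)) => t ft.
  by rewrite divff.
exact: lim_uniq p1 (subM sp pf pd).
Qed.

Definition bounded f := exists c, p (f, c).

Lemma bounded_cst c : bounded (fun=> c).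
Proof. by exists c; exact: (sub_cst sp). Qed.

Lemma boundedD f g : bounded f -> bounded g -> bounded (fun t => f t + g t).
Proof. by move=> [a fa] [b gb]; exists (a + b); exact: (subD sp). Qed.

Lemma boundedM f g : bounded f -> bounded g -> bounded (fun t => f t * g t).
Proof. by move=> [a fa] [b gb]; exists (a * b); exact: (subM sp). Qed.

Lemma boundedV f : ~ p (f, 0) -> bounded (fun t => (f t)^-1).
Proof.
move=> f0; have [//|] := lim_total p (fun t => (f t)^-1).
by under eq_fun do rewrite invrK; move=> /f0.
Qed.

Lemma lim0M f g : p (f, 0) -> bounded g -> p (fun t => f t * g t, 0).
Proof. by move=> f0 [b gb]; rewrite -(mul0r b); exact: (subM sp). Qed.

Lemma bounded_ae P f g : ae P -> (forall t, P t -> f t = g t) ->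
  bounded f -> bounded g.
Proof. by move=> aP fg [c pf]; exists c; exact: (lim_ae aP fg pf). Qed.

(** Comparison of valuations: f is at most as large as g, that is, g divides f
    in the valuation ring. *)
Definition vle f g := exists2 b, bounded b & ae (fun t => f t = b t * g t).

Lemma vle_total f g : vle f g \/ vle g f.
Proof.
have sub u v : bounded (fun t => u t / v t) -> vle u v \/ vle v u.
  move=> buv; have [v0|v0] := ae_split (fun t => v t = 0).
    right; exists (fun=> 0); first exact: bounded_cst.
    by apply: aeW v0 => t ->; rewrite mul0r.
  left; exists (fun t => u t / v t) => //.
  by apply: aeW v0 => t /eqP vt; rewrite divfK.
have [/sub//|] := lim_total p (fun t => f t / g t).
under eq_fun do rewrite invf_div.
move=> h; have : bounded (fun t => g t / f t) by exists 0.
by move=> /sub [|]; [right|left].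
Qed.

Lemma vle_trans g f h : vle f g -> vle g h -> vle f h.
Proof.
move=> [b bb fg] [b' bb' gh]; exists (fun t => b t * b' t); first exact: boundedM.
by apply: aeW (aeI fg gh) => t [-> ->]; rewrite mulrA.
Qed.

Lemma vle_lim0 f g : vle f g -> p (g, 0) -> p (f, 0).
Proof.
move=> [b bb fg] g0; apply: (lim_ae fg _ (lim0M g0 bb)) => t ->.
by rewrite mulrC.
Qed.

Definition limx m n (A : T -> 'M[F]_(m, n)) (A0 : 'M[F]_(m, n)) :=
  forall i j, p (fun t => A t i j, A0 i j).

Lemma limx_cst m n (A : 'M[F]_(m, n)) : limx (fun=> A) A.
Proof. by move=> i j; exact: (sub_cst sp). Qed.

Lemma limxM m n q (A : T -> 'M[F]_(m, n)) (B : T -> 'M[F]_(n, q)) A0 B0 :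
  limx A A0 -> limx B B0 -> limx (fun t => A t *m B t) (A0 *m B0).
Proof.
move=> lA lB i j; rewrite mxE; under eq_fun do rewrite mxE.
by apply: sub_sum => // l; exact: (subM sp).
Qed.

Lemma limx_block m n q r (A : T -> 'M[F]_(m, n)) (B : T -> 'M[F]_(m, q))
    (C : T -> 'M[F]_(r, n)) (D : T -> 'M[F]_(r, q)) A0 B0 C0 D0 :
  limx A A0 -> limx B B0 -> limx C C0 -> limx D D0 ->
  limx (fun t => block_mx (A t) (B t) (C t) (D t)) (block_mx A0 B0 C0 D0).
Proof.
move=> lA lB lC lD i j; rewrite -(splitK i) -(splitK j).
case: (split i) => i'; case: (split j) => j' /=;
  rewrite ?block_mxEul ?block_mxEur ?block_mxEdl ?block_mxEdr;
  under eq_fun do rewrite ?block_mxEul ?block_mxEur ?block_mxEdl ?block_mxEdr;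
  by [].
Qed.

Lemma limx_det m (A : T -> 'M[F]_m) A0 : limx A A0 ->
  p (fun t => \det (A t), \det A0).
Proof. by move=> lA; exact: sub_det. Qed.

Lemma limxZ m n f c (A : T -> 'M[F]_(m, n)) A0 : p (f, c) -> limx A A0 ->
  limx (fun t => f t *: A t) (c *: A0).
Proof.
move=> pf lA i j; rewrite mxE; under eq_fun do rewrite mxE.
exact: (subM sp).
Qed.

Lemma limx_inv m (A : T -> 'M[F]_m) A0 : limx A A0 -> \det A0 != 0 ->
  limx (fun t => invmx (A t)) (invmx A0).
Proof.
move=> lA A0_neq0.
have adj : limx (fun t => \adj (A t)) (\adj A0).
  move=> i j; rewrite mxE; under eq_fun do rewrite mxE.
  rewrite /cofactor; apply: (subM sp); first exact: (sub_cst sp).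
  apply: limx_det => i' j'; rewrite !mxE; under eq_fun do rewrite !mxE.
  exact: lA.
have := limxZ (limV (limx_det lA) A0_neq0) adj.
have unitE (B : 'M[F]_m) : \det B != 0 -> (\det B)^-1 *: \adj B = invmx B.
  by move=> B0; rewrite /invmx unitmxE unitfE B0.
rewrite unitE // => H i j.
apply: (lim_ae (ae_neq0 (limx_det lA) A0_neq0) _ (H i j)) => t At.
by rewrite unitE.
Qed.

(** Smith normal form over the valuation ring: a largest entry divides all the
    others, hence it serves to clear its row and its column. *)
Lemma smith m (g : T -> 'M[F]_m) : exists k k' k0 k0' (a : T -> 'rV_m),
  [/\ limx k k0, limx k' k0', \det k0 != 0, \det k0' != 0
    & ae (fun t => k t *m g t *m k' t = diag_mx (a t))].
Proof.
elim: m g => [|m IH] g.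
  exists (fun=> 1%:M), (fun=> 1%:M), 1%:M, 1%:M, (fun=> 0).
  by split; rewrite ?det1 ?oner_neq0 //; do ?exact: limx_cst; apply: aeT => t;
    rewrite [LHS]flatmx0 [RHS]flatmx0.
pose ge (x y : 'I_m.+1 * 'I_m.+1) := vle (fun t => g t y.1 y.2) (fun t => g t x.1 x.2).
have [||[i j] _ gij] := @exists_min _ ge (fun=> True) _ _ (ex_intro _ (0, 0) I).
- by move=> x y; exact: vle_total.
- by move=> x y z xy yz; apply: vle_trans yz xy.
pose h t : 'M[F]_(1 + m) := tperm_mx 0 i *m g t *m tperm_mx 0 j.
have hE t i' j' : h t i' j' = g t (tperm 0 i i') (tperm 0 j j').
  by rewrite /h -!xrowE -!xcolE !mxE.
have hdef t : h t = tperm_mx 0 i *m g t *m tperm_mx 0 j by [].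
clearbody h.
have hle i' j' : vle (fun t => h t i' j') (fun t => h t 0 0).
  under eq_fun do rewrite hE; under [X in vle _ X]eq_fun do rewrite hE !tpermL.
  exact: (gij (_, _)).
have /boolp.choice [c cP] : forall i' : 'I_m, exists c : (T -> F) * F, p c /\
    ae (fun t => h t (rshift 1 i') 0 = c.1 t * h t 0 0).
  move=> i'; have [b [c bc] H] := hle (rshift 1 i') 0.
  by exists (b, c).
have /boolp.choice [r rP] : forall i' : 'I_m, exists r : (T -> F) * F, p r /\
    ae (fun t => h t 0 (rshift 1 i') = r.1 t * h t 0 0).
  move=> i'; have [b [r br] H] := hle 0 (rshift 1 i').
  by exists (b, r).
pose C t := \col_i' (c i').1 t; pose C0 := \col_i' (c i').2.
pose R t := \row_i' (r i').1 t; pose R0 := \row_i' (r i').2.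
have limC : limx (fun t => - C t) (- C0).
  move=> i' j'; rewrite !mxE; under eq_fun do rewrite !mxE.
  by apply: limN; have [] := cP i'; case: (c i').
have limR : limx (fun t => - R t) (- R0).
  move=> i' j'; rewrite !mxE; under eq_fun do rewrite !mxE.
  by apply: limN; have [] := rP j'; case: (r j').
have [k [k' [k0 [k0' [a [lk lk' dk dk' kgk]]]]]] :=
  IH (fun t => drsubmx (h t) - h t 0 0 *: (C t *m R t)).
exists (fun t => block_mx 1%:M 0 0 (k t) *m block_mx 1%:M 0 (- C t) 1%:M *m tperm_mx 0 i).
exists (fun t => tperm_mx 0 j *m block_mx 1%:M (- R t) 0 1%:M *m block_mx 1%:M 0 0 (k' t)).
exists (block_mx 1%:M 0 0 k0 *m block_mx 1%:M 0 (- C0) 1%:M *m tperm_mx 0 i).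
exists (tperm_mx 0 j *m block_mx 1%:M (- R0) 0 1%:M *m block_mx 1%:M 0 0 k0').
exists (fun t => row_mx ((h t 0 0)%:M) (a t)).
have tpermN0 (l : 'I_(1 + m)) : \det (tperm_mx 0 l : 'M[F]_(1 + m)) != 0.
  by rewrite det_perm signr_eq0.
have dl (x : 'cV_m) (K : 'M[F]_m) : \det (block_mx 1%:M 0 x K : 'M_(1 + m)) = \det K.
  by rewrite det_lblock det1 mul1r.
have du (x : 'rV_m) (K : 'M[F]_m) : \det (block_mx 1%:M x 0 K : 'M_(1 + m)) = \det K.
  by rewrite det_ublock det1 mul1r.
split.
- by do ?[apply: limxM | apply: (@limx_block 1 1 m m)]; do ?exact: limx_cst.
- by do ?[apply: limxM | apply: (@limx_block 1 1 m m)]; do ?exact: limx_cst.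
- by rewrite !det_mulmx !dl det1 mulr1 mulf_neq0.
- by rewrite !det_mulmx !du det1 mulr1 mulf_neq0.
have aeC : ae (fun t => forall i', h t (rshift 1 i') 0 = (c i').1 t * h t 0 0).
  by apply: ae_forall => i'; have [] := cP i'.
have aeR : ae (fun t => forall i', h t 0 (rshift 1 i') = (r i').1 t * h t 0 0).
  by apply: ae_forall => i'; have [] := rP i'.
apply: aeW (aeI kgk (aeI aeC aeR)) => t [kgkt [Ct Rt]].
have -> : block_mx 1%:M 0 0 (k t) *m block_mx 1%:M 0 (- C t) 1%:M *m tperm_mx 0 i *m g t *m
    (tperm_mx 0 j *m block_mx 1%:M (- R t) 0 1%:M *m block_mx 1%:M 0 0 (k' t)) =
  block_mx 1%:M 0 0 (k t) *m (block_mx 1%:M 0 (- C t) 1%:M *m h t *m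
   block_mx 1%:M (- R t) 0 1%:M) *m block_mx 1%:M 0 0 (k' t) by rewrite hdef !mulmxA.
have hb : h t = block_mx (h t 0 0)%:M (h t 0 0 *: R t) (h t 0 0 *: C t) (drsubmx (h t)).
  rewrite -[LHS]submxK; congr block_mx; apply/matrixP => i' j'; rewrite !ord1 !mxE.
  - by rewrite eqxx mulr1n; congr (h t _ _); apply: val_inj.
  - by rewrite mulrC -Rt; congr (h t _ _); apply: val_inj.
  - by rewrite mulrC -Ct; congr (h t _ _); apply: val_inj.
rewrite {1}hb !mulmx_block !(mul1mx, mulmx1, mul0mx, mulmx0, addr0, add0r).
rewrite [RHS](diag_mx_row ((h t 0 0)%:M : 'rV_1) (a t)).
apply: (f_equal4 (@block_mx F 1 m 1 m)).
- by apply/matrixP => i' j'; rewrite !mxE !ord1.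
- by rewrite mul_scalar_mx scalerN addNr mul0mx.
- by rewrite mulNmx mul_mx_scalar addNr mulmx0.
rewrite -kgkt mulNmx mul_mx_scalar addNr mul0mx add0r; congr (_ *m _ *m _).
by rewrite mulNmx -scalemxAr addrC.
Qed.

(** The analogue over the valuation ring of the decomposition of SL as K A K,
    with K the integral points and A the torus. It is the Smith form, rescaled so
    that the three factors have determinant 1. *)
Lemma cartan m (g : T -> 'M[F]_m.+1) : (forall t, \det (g t) = 1) ->
  exists (a : T -> 'rV_m.+1) k k' k0 k0',
  [/\ forall t, \prod_i a t 0 i = 1, limx k k0 /\ \det k0 = 1,
      limx k' k0' /\ \det k0' = 1
    & ae (fun t => diag_mx (a t) *m k' t = k t *m g t)].
Proof.
move=> g1; have [k [k' [k0 [k0' [a [lk lk' dk dk' kgk]]]]]] := smith g.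
pose u (x : F) : 'rV[F]_m.+1 := \row_i if i == 0 then x else 1.
have detu x : \det (diag_mx (u x)) = x.
  rewrite det_diag big_ord_recl mxE eqxx big1 ?mulr1 // => i _.
  by rewrite mxE -(inj_eq val_inj).
have limu f c : p (f, c) -> limx (fun t => diag_mx (u (f t))) (diag_mx (u c)).
  move=> pf i j; rewrite !mxE; under eq_fun do rewrite !mxE.
  by case: (i == j) => //; case: (i == 0); rewrite ?mulr1n ?mulr0n //; exact: (sub_cst sp).
pose e t := (\det (k t))^-1; pose e0 := (\det k0)^-1.
pose e' t := \det (k' t); pose e0' := \det k0'.
have le : p (e, e0) by exact/limV/dk/limx_det.
have le' : p (e', e0') by exact: limx_det.
pose a1 t := \row_i (u (e t) 0 i * a t 0 i * u (e' t)^-1 0 i).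
have da1 t : diag_mx (a1 t) = diag_mx (u (e t)) *m diag_mx (a t) *m diag_mx (u (e' t)^-1).
  by rewrite !mulmx_diag; congr diag_mx; apply/rowP => i; rewrite !mxE.
(* a1 has determinant 1 only almost everywhere *)
pose b t := if \prod_i a1 t 0 i == 1 then a1 t else const_mx 1.
have ne := aeI (ae_neq0 (limx_det lk) dk) (ae_neq0 (limx_det lk') dk').
exists b, (fun t => diag_mx (u (e t)) *m k t), (fun t => diag_mx (u (e' t)) *m invmx (k' t)).
exists (diag_mx (u e0) *m k0), (diag_mx (u e0') *m invmx k0').
split.
- move=> t; rewrite /b; case: eqP => // _.
  by rewrite big1 // => i _; rewrite mxE.
- split; first by apply: limxM => //; exact: limu.
  by rewrite det_mulmx detu mulVf.
- split; first by apply: limxM; [exact: limu | exact: limx_inv].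
  by rewrite det_mulmx detu det_inv divff.
apply: aeW (aeI kgk ne) => t [kgkt [kt kt']].
have k'u : k' t \in unitmx by rewrite unitmxE unitfE.
have main : diag_mx (a1 t) *m (diag_mx (u (e' t)) *m invmx (k' t)) =
    diag_mx (u (e t)) *m k t *m g t.
  rewrite da1 -!mulmxA; congr (_ *m _); rewrite !mulmxA.
  rewrite -[X in X *m invmx _]mulmxA mulmx_diag.
  have -> : diag_mx (\row_i (u (e' t)^-1 0 i * u (e' t) 0 i)) = 1%:M.
    rewrite -diag_const_mx; congr diag_mx; apply/rowP => i; rewrite !mxE.
    by case: (i == 0); rewrite ?mulVf ?mulr1.
  by rewrite mulmx1 -kgkt mulmxK.
rewrite /b; case: eqP => // [[]].
have := congr1 determinant main.
rewrite !det_mulmx !detu g1 mulVf // mulr1 det_inv divff // mulr1 det_diag.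
by [].
Qed.

End PlaceTheory.

(** * The Cauchy-Binet formula and exterior powers *)

Section CauchyBinet.
Variables (F : fieldType) (m : nat).

Lemma det_colE (A : 'M[F]_m) : \det A = \sum_(s : 'S_m) (-1) ^+ s * \prod_j A (s j) j.
Proof.
rewrite -det_tr; apply: eq_bigr => s _; congr (_ * _).
by apply: eq_bigr => j _; rewrite mxE.
Qed.

Lemma det_sum (I : finType) (A : 'I_m -> I -> F) (B : I -> 'I_m -> F) :
  \det (\matrix_(i < m, j < m) \sum_l A i l * B l j) =
  \sum_(f : {ffun 'I_m -> I})
    \det (\matrix_(i < m, j < m) A i (f j)) * \prod_j B (f j) j.
Proof.
rewrite det_colE; under [RHS]eq_bigr => f _ do rewrite det_colE mulr_suml.
rewrite exchange_big /=; apply: eq_bigr => s _.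
under [X in _ * X]eq_bigr => j _ do rewrite !mxE.
rewrite bigA_distr_bigA mulr_sumr; apply: eq_bigr => f _.
rewrite big_split mulrA; congr (_ * _ * _); apply: eq_bigr => j _.
by rewrite !mxE.
Qed.

Lemma det_not_injective (I : Type) (A : 'I_m -> I -> F) (f : 'I_m -> I) :
  ~ injective f -> \det (\matrix_(i < m, j < m) A i (f j)) = 0.
Proof.
move=> ninj; rewrite -det_tr.
have [j [j' [fj jj']]] : exists j j', f j = f j' /\ j != j'.
  apply: contrapT => H; apply: ninj => j j' fj; apply/eqP; apply: contrapT => /negP jj'.
  by apply: H; exists j, j'.
by apply: (determinant_alternate jj') => i; rewrite !mxE fj.
Qed.

Let perm_of (N : nat) (x : increasing_tuple m N * 'S_m) : {ffun 'I_m -> 'I_N} :=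
  [ffun j => tnth (val x.1) (x.2 j)].

Lemma increasing_tuple_inj N (t : increasing_tuple m N) : injective (tnth (val t)).
Proof.
case: t => t /= st; apply/tuple_uniqP.
have : uniq (map val t) by apply: sorted_uniq st; [exact: ltn_trans | exact: ltnn].
exact: map_uniq.
Qed.

Lemma perm_of_inj N : injective (@perm_of N).
Proof.
move=> [t s] [t' s'] /ffunP tt'.
have tE j : tnth (val t) (s j) = tnth (val t') (s' j) by have := tt' j; rewrite !ffunE.
have tt : t = t'.
  apply/val_inj/val_inj/(inj_map val_inj).
  apply: (irr_sorted_eq ltn_trans ltnn (valP t) (valP t')) => x.
  apply/mapP/mapP => [] [y /tnthP [j ->] ->].
    exists (tnth (val t') (s' (s^-1%g j))); first exact: mem_tnth.
    by rewrite -tE permKV.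
  exists (tnth (val t) (s (s'^-1%g j))); first exact: mem_tnth.
  by rewrite tE permKV.
rewrite tt in tE *; congr (_, _); apply/permP => j.
exact: (increasing_tuple_inj (tE j)).
Qed.

Lemma perm_of_surj N (f : {ffun 'I_m -> 'I_N}) : injective f ->
  exists x, f = perm_of x.
Proof.
move=> fi; pose c := [tuple f j | j < m].
pose r := relpre val leq : rel 'I_N.
have uc : uniq c by rewrite map_inj_uniq ?enum_uniq.
have sc : sorted ltn (map val (sort_tuple r c)).
  rewrite ltn_sorted_uniq_leq map_inj_uniq ?sort_uniq ?uc; last exact: val_inj.
  by rewrite sorted_map; apply: sort_sorted => x y; exact: leq_total.
have /tuple_permP [s cs] : perm_eq c (sort_tuple r c) by rewrite perm_sym perm_sort.
exists (exist _ (sort_tuple r c) sc, s); apply/ffunP => j; rewrite ffunE /=.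
have {}cs : c = [tuple tnth (sort_tuple r c) (s i) | i < m] by exact: val_inj.
by have := congr1 (fun u => tnth u j) cs; rewrite !tnth_mktuple.
Qed.

(** In the multilinear expansion of the determinant, the terms of index
    functions that are not injective vanish, and each injective function is in a
    unique way an increasing one composed with a permutation. *)
Lemma cauchy_binet N (A : 'I_m -> 'I_N -> F) (B : 'I_N -> 'I_m -> F) :
  \det (\matrix_(i < m, j < m) \sum_l A i l * B l j) =
  \sum_(t : increasing_tuple m N)
    \det (\matrix_(i < m, j < m) A i (tnth (val t) j)) *
    \det (\matrix_(i < m, j < m) B (tnth (val t) i) j).
Proof.
rewrite det_sum (bigID [in @perm_of N @: [set: _]%SET]) /= [X in _ + X]big1 ?addr0; last first.
  move=> f fN; rewrite det_not_injective ?mul0r // => /perm_of_surj [x fx].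
  by case/negP: fN; rewrite fx imset_f.
rewrite big_imset /=; last by move=> x y _ _; exact: perm_of_inj.
under eq_bigl do rewrite inE.
rewrite -(pair_bigA _ (fun t s => \det (\matrix_(i, j) A i (@perm_of N (t, s) j)) *
   \prod_j B (@perm_of N (t, s) j) j)) /=.
apply: eq_bigr => t _; rewrite [X in _ = _ * X]det_colE mulr_sumr; apply: eq_bigr => s _.
rewrite mulrA; congr (_ * _); last first.
  by apply: eq_bigr => j _; rewrite !mxE ffunE.
have -> : \matrix_(i, j) A i (@perm_of N (t, s) j) =
    col_perm s (\matrix_(i < m, j < m) A i (tnth (val t) j)).
  by apply/matrixP => i j; rewrite !mxE ffunE.
by rewrite col_permE det_mulmx det_perm odd_permV.
Qed.

End CauchyBinet.

Section Wedge.
Variables (F : fieldType) (V : vectType F) (m : nat).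

(** The minors in any system of coordinates are thus linear functions of the
    Pluecker coordinates. *)
Lemma det_wedge (l : 'I_m -> V -> F) (v : m.-tuple V) :
  (forall j, linear_for *%R (l j)) ->
  \det (\matrix_(i < m, j < m) l j (tnth v i)) =
  \sum_(t : increasing_tuple m (\dim {:V})) wedge v t *
    \det (\matrix_(i < m, j < m) l j (tnth (vbasis {:V}) (tnth (val t) i))).
Proof.
move=> lin.
have lE j w : l j w = \sum_i coord (vbasis {:V}) i w * l j (tnth (vbasis {:V}) i).
  pose L := GRing.isLinear.Build _ _ _ _ (l j) (lin j).
  pose l' : {linear V -> F | *%R} := HB.pack (l j) L.
  rewrite {1}(coord_vbasis (memvf w)) -[l j]/(l' : V -> F) linear_sum.
  by apply: eq_bigr => i _; rewrite linearZ (tnth_nth 0).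
under eq_mx do rewrite lE.
rewrite (cauchy_binet (fun i s => coord (vbasis {:V}) s (tnth v i))
  (fun s j => l j (tnth (vbasis {:V}) s))).
by apply: eq_bigr => t _; rewrite ffunE.
Qed.

Lemma extpow_map_wedge (phi : V -> V) (v : m.-tuple V) : linear phi ->
  extpow_map phi (wedge v) = wedge [tuple phi (tnth v i) | i < m].
Proof.
move=> lin; apply/ffunP => t; rewrite sum_ffunE ffunE.
under [X in _ = \det X]eq_mx do rewrite tnth_mktuple.
rewrite (@det_wedge (fun j w => coord (vbasis {:V}) (tnth (val t) j) (phi w))); last first.
  by move=> j a x y; rewrite lin linearP.
apply: eq_bigr => s _; rewrite !ffunE; congr (_ * \det _).
by apply/matrixP => i j; rewrite !mxE tnth_mktuple.
Qed.

End Wedge.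

(** * The action on forms *)

Section Action.
Variables (F : fieldType) (n d : nat).
Notation forms := (forms F n d).
Implicit Types (f : forms) (g h : 'M[F]_n.+1) (b : 'X_{1..n.+1}).

Definition fcoef b f : F := (f : {mpoly F[n.+1]})@_b.

Lemma fcoef_is_linear b : linear_for *%R (fcoef b).
Proof. by move=> c f f'; rewrite /fcoef /= mcoeffD mcoeffZ. Qed.

Lemma fcoef_sum b m (c : 'I_m -> F) (f : 'I_m -> forms) :
  fcoef b (\sum_i c i *: f i) = \sum_i c i * fcoef b (f i).
Proof.
rewrite /fcoef raddf_sum raddf_sum; apply: eq_bigr => i _.
by rewrite /= mcoeffZ.
Qed.

Definition mon_form b : forms := indhomog d 'X_[b].

Lemma formE f : f = \sum_(b : 'X_{1..n.+1 < d.+1}) fcoef b f *: mon_form b.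
Proof.
apply/val_inj; rewrite raddf_sum /=.
have sf : (msize (f : {mpoly F[n.+1]}) <= d.+1)%N.
  case: f => f /= /dhomogP fd; rewrite msizeE; apply/bigmax_leqP_seq => b bf _.
  by rewrite ltnS; have /= -> := fd _ bf.
rewrite [LHS](mpolywE sf); apply: eq_bigr => b _.
rewrite -[RHS]/(fcoef b f *: (val (mon_form b))) /fcoef.
have [bd|bd] := eqVneq (mdeg b) d; last first.
  by rewrite (dhomog_nemf_coeff _ bd) ?scale0r //; case: (f).
have hX : ('X_[b] : {mpoly F[n.+1]}) \is d.-homog by rewrite dhomogX /= bd.
by congr (_ *: _); rewrite /mon_form /indhomog insubdK.
Qed.

Lemma fcoef_inj f f' : (forall b : 'X_{1..n.+1 < d.+1}, fcoef b f = fcoef b f') -> f = f'.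
Proof. by move=> ff'; rewrite (formE f) (formE f'); apply: eq_bigr => b _; rewrite ff'. Qed.

Lemma linear_fcoef (l : forms -> F) f : linear_for *%R l ->
  l f = \sum_(b : 'X_{1..n.+1 < d.+1}) fcoef b f * l (mon_form b).
Proof.
move=> lin; pose L := GRing.isLinear.Build _ _ _ _ l lin.
pose l' : {linear forms -> F | *%R} := HB.pack l L.
rewrite {1}(formE f) -[l]/(l' : forms -> F) linear_sum.
by apply: eq_bigr => b _; rewrite linearZ.
Qed.

Lemma form_act_is_linear g : linear (@form_act F n d g).
Proof.
move=> c f f'; apply/val_inj => /=.
by rewrite comp_mpolyD comp_mpolyZ.
Qed.

HB.instance Definition _ g :=
  GRing.isLinear.Build F forms forms *:%R (@form_act F n d g) (form_act_is_linear g).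

Lemma form_act_sum g m (c : 'I_m -> F) (f : 'I_m -> forms) :
  form_act g (\sum_i c i *: f i) = \sum_i c i *: form_act g (f i).
Proof. by rewrite linear_sum; apply: eq_bigr => i _; rewrite linearZ. Qed.

Lemma form_actM g h f : form_act g (form_act h f) = form_act (g *m h) f.
Proof.
apply/val_inj => /=; rewrite [in RHS]comp_mpolyE [X in X \mPo _]comp_mpolyE.
rewrite raddf_sum; apply: eq_bigr => b _ /=.
rewrite comp_mpolyZ rmorph_prod; congr (_ *: _); apply: eq_bigr => i _.
rewrite rmorphXn /=; congr (_ ^+ _); rewrite !tnth_mktuple raddf_sum /=.
under eq_bigr => j _.
  rewrite comp_mpolyZ comp_mpolyXU -tnth_nth tnth_mktuple scaler_sumr.
  over.
rewrite exchange_big; apply: eq_bigr => j _ /=; rewrite mxE scaler_suml.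
by apply: eq_bigr => l _; rewrite scalerA mulrC.
Qed.

Lemma form_act1 f : form_act 1%:M f = f.
Proof.
apply/val_inj => /=.
have -> : linear_change (1%:M : 'M[F]_n.+1) = [tuple 'X_i | i < n.+1].
  apply: eq_from_tnth => j; rewrite !tnth_mktuple (bigD1 j) //= big1 ?addr0.
    by rewrite mxE eqxx scale1r.
  by move=> i /negPf ij; rewrite mxE ij scale0r.
by rewrite comp_mpoly_id.
Qed.

Definition torus_mon (a : 'rV[F]_n.+1) b := \prod_i a 0 i ^+ b i.

(** Monomials are the weight vectors of the diagonal torus. *)
Lemma fcoef_diag (a : 'rV[F]_n.+1) f b :
  fcoef b (form_act (diag_mx a) f) = torus_mon a b * fcoef b f.
Proof.
rewrite /fcoef /= comp_mpolyE raddf_sum /=.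
have E (c : 'X_{1..n.+1}) : \prod_i tnth (linear_change (diag_mx a)) i ^+ c i =
    torus_mon a c *: 'X_[c].
  rewrite mpolyXE_id /torus_mon -scaler_prod; apply: eq_bigr => i _.
  rewrite tnth_mktuple (bigD1 i) //= big1 ?addr0 ?mxE ?eqxx ?exprZn // => j /negPf ji.
  by rewrite mxE ji scale0r.
under eq_bigr => c _ do rewrite mcoeffZ E mcoeffZ mcoeffX.
have [bf|bf] := boolP (b \in msupp (f : {mpoly F[n.+1]})); last first.
  rewrite (memN_msupp_eq0 bf) mulr0 big_seq big1 // => c cin.
  by have [cb|_] := eqVneq c b; [rewrite -cb cin in bf | rewrite !mulr0].
rewrite (bigD1_seq b) ?msupp_uniq //= eqxx mulr1 big1 ?addr0 1?mulrC // => c /negPf ->.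
by rewrite !mulr0.
Qed.

End Action.

Section LimitAction.
Variables (T : Type) (F : fieldType) (p : place T F) (n d : nat).
Notation forms := (forms F n d).
Let sp := place_sub p.

Definition limp (q : T -> {mpoly F[n.+1]}) (q0 : {mpoly F[n.+1]}) :=
  forall b, p (fun t => (q t)@_b, q0@_b).

Lemma limp_cst q : limp (fun=> q) q.
Proof. by move=> b; exact: (sub_cst sp). Qed.

Lemma limp_sum (I : Type) (r : seq I) (q : I -> T -> {mpoly F[n.+1]}) q0 :
  (forall i, limp (q i) (q0 i)) ->
  limp (fun t => \sum_(i <- r) q i t) (\sum_(i <- r) q0 i).
Proof.
move=> lq b; rewrite raddf_sum; under eq_fun do rewrite raddf_sum.
by apply: sub_sum => // i; exact: lq.
Qed.

Lemma limpZ f c q q0 : p (f, c) -> limp q q0 -> limp (fun t => f t *: q t) (c *: q0).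
Proof.
move=> pf lq b; rewrite mcoeffZ; under eq_fun do rewrite mcoeffZ.
exact: (subM sp).
Qed.

Lemma limpM q q' q0 q0' : limp q q0 -> limp q' q0' ->
  limp (fun t => q t * q' t) (q0 * q0').
Proof.
move=> lq lq' b; rewrite mcoeffM; under eq_fun do rewrite mcoeffM.
rewrite big_mkcond; under eq_fun do rewrite big_mkcond.
apply: sub_sum => // k; case: (b == _); last exact: (sub_cst sp).
exact: (subM sp).
Qed.

Lemma limp_prod (I : Type) (r : seq I) (q : I -> T -> {mpoly F[n.+1]}) q0 :
  (forall i, limp (q i) (q0 i)) ->
  limp (fun t => \prod_(i <- r) q i t) (\prod_(i <- r) q0 i).
Proof.
move=> lq; elim: r => [|i r IH].
  by rewrite big_nil; under eq_fun do rewrite big_nil; exact: limp_cst.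
by rewrite big_cons; under eq_fun do rewrite big_cons; exact: limpM.
Qed.

Lemma lim_form_act (k : T -> 'M[F]_n.+1) k0 (f : forms) (l : forms -> F) :
  linear_for *%R l -> limx p k k0 ->
  p (fun t => l (form_act (k t) f), l (form_act k0 f)).
Proof.
move=> lin lk; rewrite (linear_fcoef _ lin); under eq_fun do rewrite (linear_fcoef _ lin).
apply: sub_sum => // b; apply: (subM sp); last exact: (sub_cst sp).
rewrite /fcoef /= comp_mpolyE; under eq_fun do rewrite comp_mpolyE.
move: (val b); apply: limp_sum => c; apply: limpZ; first exact: (sub_cst sp).
apply: limp_prod => i; elim: (c i) => [|e IH].
  by rewrite expr0; under eq_fun do rewrite expr0; exact: limp_cst.
rewrite exprS; under eq_fun do rewrite exprS.
apply: limpM => //; rewrite tnth_mktuple; under eq_fun do rewrite tnth_mktuple.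
by apply: limp_sum => j; apply: limpZ; [exact: lk | exact: limp_cst].
Qed.

End LimitAction.

(** * Pluecker coordinates at monomials *)

Section Minors.
Variables (F : fieldType) (n d : nat).
Notation forms := (forms F n d).
Notation mon := 'X_{1..n.+1 < d.+1}.

Definition act_tuple m (g : 'M[F]_n.+1) (v : m.-tuple forms) : m.-tuple forms :=
  [tuple form_act g (tnth v i) | i < m].

Lemma plucker_act_wedge m g (v : m.-tuple forms) :
  plucker_act g (wedge v) = wedge (act_tuple g v).
Proof. exact/extpow_map_wedge/form_act_is_linear. Qed.

Lemma act_tupleM m g h (v : m.-tuple forms) :
  act_tuple g (act_tuple h v) = act_tuple (g *m h) v.
Proof. by apply: eq_from_tnth => i; rewrite !tnth_mktuple form_actM. Qed.

Lemma act_tuple1 m (v : m.-tuple forms) : act_tuple 1%:M v = v.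
Proof. by apply: eq_from_tnth => i; rewrite tnth_mktuple form_act1. Qed.

(** Unlike the coordinates of [wedge], whose basis of forms is arbitrary, these
    ones are weight vectors of the torus. All families s are allowed, increasing
    or not: only the vanishing and the size of minors matter. *)
Definition minor m (s : {ffun 'I_m -> mon}) (v : m.-tuple forms) : F :=
  \det (\matrix_(i < m, j < m) fcoef (s j) (tnth v i)).

Lemma minor_wedge m (s : {ffun 'I_m -> mon}) : exists c, forall v : m.-tuple forms,
  minor s v = \sum_t wedge v t * c t.
Proof.
eexists => v; apply: (@det_wedge _ _ _ (fun j => fcoef (s j)) v) => j.
exact: fcoef_is_linear.
Qed.

Lemma wedge_minor m t : exists c, forall v : m.-tuple forms,
  wedge v t = \sum_s minor s v * c s.
Proof.
pose l j : forms -> F := coord (vbasis {:forms}) (tnth (val t) j).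
have lin j : linear_for *%R (l j) by move=> a x y; rewrite /l linearP.
exists (fun s : {ffun 'I_m -> mon} => \prod_j l j (mon_form F d (s j))) => v.
rewrite ffunE -/(l _ _).
rewrite -(det_sum (fun i (b : mon) => fcoef b (tnth v i)) (fun b j => l j (mon_form F d b))).
by congr (\det _); apply/matrixP => i j; rewrite !mxE -linear_fcoef.
Qed.

Lemma wedge_eq m (v w : m.-tuple forms) : (forall s, minor s v = minor s w) ->
  wedge v = wedge w.
Proof.
move=> vw; apply/ffunP => t; have [c cE] := wedge_minor t.
by rewrite !cE; apply: eq_bigr => s _; rewrite vw.
Qed.

Lemma minor_diag m (s : {ffun 'I_m -> mon}) a (v : m.-tuple forms) :
  minor s (act_tuple (diag_mx a) v) = (\prod_j torus_mon a (s j)) * minor s v.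
Proof.
rewrite /minor.
have -> : \matrix_(i, j) fcoef (s j) (tnth (act_tuple (diag_mx a) v) i) =
    (\matrix_(i, j) fcoef (s j) (tnth v i)) *m diag_mx (\row_j torus_mon a (s j)).
  apply/matrixP => i j; rewrite mul_mx_diag !mxE tnth_mktuple fcoef_diag.
  exact: mulrC.
rewrite det_mulmx det_diag mulrC; congr (_ * _).
by apply: eq_bigr => j _; rewrite mxE.
Qed.

Lemma minor_comb m (s : {ffun 'I_m -> mon}) (P : 'M[F]_m) (v w : m.-tuple forms) :
  (forall i, tnth w i = \sum_j P i j *: tnth v j) ->
  minor s w = \det P * minor s v.
Proof.
move=> wE; rewrite /minor -det_mulmx; congr (\det _); apply/matrixP => i j.
by rewrite !mxE wE fcoef_sum; apply: eq_bigr => l _; rewrite mxE.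
Qed.

Lemma exists_minor m (v : m.-tuple forms) : free v -> exists s, minor s v != 0.
Proof.
move=> vfree.
pose M := \matrix_(i < m, b < #|{: mon}|) fcoef (enum_val b) (tnth v i).
have Mfree : row_free M.
  apply: inj_row_free => w wM; apply/rowP => i; rewrite mxE.
  move/freeP: vfree => /(_ (w 0)); apply; apply: fcoef_inj => b.
  rewrite fcoef_sum [RHS]/fcoef /= mcoeff0.
  have /rowP/(_ (enum_rank b)) := wM; rewrite !mxE => wb; rewrite -[RHS]wb.
  by apply: eq_bigr => j _; rewrite mxE enum_rankK (tnth_nth 0).
have Mfull : row_full M^T by rewrite /row_full mxrank_tr.
exists [ffun j => enum_val (fullrankfun Mfull j)].
have := fullrowsub_unit Mfull; rewrite unitmxE unitfE -det_tr.
congr (\det _ != 0); apply/matrixP => i j; by rewrite !mxE [in RHS]ffunE.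
Qed.

End Minors.

Section Small.
Variables (T : Type) (F : fieldType) (p : place T F).
Let sp := place_sub p.
Implicit Types (f g : T -> F).

(** The maximal ideal of the valuation ring serves for instability, the unit
    ideal for non-stability; the argument only uses that they are ideals. *)
Definition small (b : bool) f := if b then p (f, 0) else bounded p f.

Lemma small_ae b P f g : ae p P -> (forall t, P t -> f t = g t) -> small b f -> small b g.
Proof. by case: b; [exact: lim_ae | exact: bounded_ae]. Qed.

Lemma smallM b f g : small b f -> bounded p g -> small b (fun t => f t * g t).
Proof. by case: b; [exact: lim0M | exact: boundedM]. Qed.

Lemma small_sum b (I : Type) (r : seq I) (f : I -> T -> F) :
  (forall i, small b (f i)) -> small b (fun t => \sum_(i <- r) f i t).
Proof.
move=> fs; elim: r => [|i r IH].
  under eq_fun do rewrite big_nil.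
  by case: b fs => _; [exact: (sub_cst sp) | exact: bounded_cst].
under eq_fun do rewrite big_cons.
case: b fs IH => fs IH; last exact: (boundedD (fs i) IH).
by have := subD sp (fs i) IH; rewrite addr0.
Qed.

End Small.

(** * The hyperplane of a linear system *)

Section Hyperplane.
Variables (T : Type) (F : fieldType) (p : place T F) (n d : nat).
Notation forms := (forms F n d).
Notation mon := 'X_{1..n.+1 < d.+1}.
Let sp := place_sub p.

Lemma lim_polyfun (W : vectType F) (u : T -> W) w (q : {mpoly F[\dim {:W}]}) :
  (forall i, p (fun t => coord (vbasis {:W}) i (u t), coord (vbasis {:W}) i w)) ->
  p (fun t => polyfun q (u t), polyfun q w).
Proof.
move=> lu; rewrite /polyfun mevalE; under eq_fun do rewrite mevalE.
apply: sub_sum => // c; apply: (subM sp); first exact: (sub_cst sp).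
apply: sub_prod => // i; elim: (c i) => [|e IH].
  by rewrite expr0; under eq_fun do rewrite expr0; exact: (sub_cst sp).
by rewrite exprS; under eq_fun do rewrite exprS; exact: (subM sp).
Qed.

(** Polynomials commute with limits. *)
Lemma lim_closure (W : vectType F) (A : W -> Prop) (u : T -> W) w :
  (forall t, A (u t)) ->
  (forall i, p (fun t => coord (vbasis {:W}) i (u t), coord (vbasis {:W}) i w)) ->
  zariski_closure A w.
Proof.
move=> Au lu q qA; have := lim_polyfun q lu.
under eq_fun do rewrite qA //.
by move=> /lim_uniq; apply; exact: (sub_cst sp).
Qed.

Lemma lim_coord_of_extpow m (u : T -> extpow forms m) (w : extpow forms m) :
  (forall t', p (fun t => u t t', w t')) ->
  forall i, p (fun t => coord (vbasis {:extpow forms m}) i (u t),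
               coord (vbasis {:extpow forms m}) i w).
Proof.
move=> lu i.
pose e t' : extpow forms m := [ffun x => (x == t')%:R].
have uE (x : extpow forms m) : x = \sum_t' x t' *: e t'.
  apply/ffunP => t'; rewrite sum_ffunE (bigD1 t') //= !ffunE eqxx big1.
    by rewrite addr0 [RHS]mulr1.
  by move=> s /negPf st; rewrite !ffunE eq_sym st scaler0.
have cE x : coord (vbasis {:extpow forms m}) i x =
    \sum_t' x t' * coord (vbasis {:extpow forms m}) i (e t').
  by rewrite {1}(uE x) linear_sum; apply: eq_bigr => t' _; rewrite linearZ.
rewrite cE; under eq_fun do rewrite cE.
by apply: sub_sum => // t'; apply: (subM sp) => //; exact: (sub_cst sp).
Qed.

Lemma small_act_bounded b m (k : T -> 'M[F]_n.+1) k0 (u : T -> m.-tuple forms) :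
  limx p k k0 -> (forall t', small p b (fun t => wedge (u t) t')) ->
  forall t', small p b (fun t => wedge (act_tuple (k t) (u t)) t').
Proof.
move=> lk su t'; under eq_fun do rewrite -plucker_act_wedge.
rewrite /plucker_act /extpow_map; under eq_fun do rewrite sum_ffunE.
apply: small_sum => s; under eq_fun do rewrite ffunE.
apply: smallM => //; rewrite /bounded.
exists (wedge [tuple form_act k0 (tnth (vbasis {:forms}) (tnth (val s) i)) | i < m] t').
rewrite ffunE; under eq_fun do rewrite ffunE.
apply: limx_det => i j; rewrite mxE tnth_mktuple.
under eq_fun do rewrite mxE tnth_mktuple.
apply: (@lim_form_act _ _ p n d _ _ _ (coord (vbasis {:forms}) (tnth (val t') j))) => //.
by move=> c x y; rewrite linearP.
Qed.

Lemma small_minor b m (u : T -> m.-tuple forms) :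
  (forall t', small p b (fun t => wedge (u t) t')) <->
  (forall s, small p b (fun t => minor s (u t))).
Proof.
split=> [su s|su t'].
  have [c cE] := minor_wedge F s; under eq_fun do rewrite cE.
  by apply: small_sum => r; apply: smallM => //; exact: bounded_cst.
have [c cE] := wedge_minor t'; under eq_fun do rewrite cE.
by apply: small_sum => r; apply: smallM => //; exact: bounded_cst.
Qed.

Lemma lim_minor_act m (k : T -> 'M[F]_n.+1) k0 (v : m.-tuple forms) s :
  limx p k k0 -> p (fun t => minor s (act_tuple (k t) v), minor s (act_tuple k0 v)).
Proof.
move=> lk; apply: limx_det => i j; rewrite mxE tnth_mktuple.
under eq_fun do rewrite mxE tnth_mktuple.
by apply: lim_form_act => //; exact: fcoef_is_linear.
Qed.

Lemma bounded_limx m1 m2 (A : T -> 'M[F]_(m1, m2)) :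
  (forall i j, bounded p (fun t => A t i j)) -> exists A0, limx p A A0.
Proof.
move=> bA; have /boolp.choice [c cP] : forall x : 'I_m1 * 'I_m2, exists c,
    p (fun t => A t x.1 x.2, c) by move=> [i j]; exact: bA.
exists (\matrix_(i, j) c (i, j)) => i j; rewrite mxE.
exact: (cP (i, j)).
Qed.

Lemma lin_comb m1 m2 (W : lmodType F) (c : 'I_m1 -> F) (P : 'I_m1 -> 'I_m2 -> F)
    (x : 'I_m2 -> W) :
  \sum_i c i *: (\sum_j P i j *: x j) = \sum_j (\sum_i c i * P i j) *: x j.
Proof.
under eq_bigr do rewrite scaler_sumr.
rewrite exchange_big; apply: eq_bigr => j _ /=; rewrite scaler_suml.
by apply: eq_bigr => i _; rewrite scalerA.
Qed.

(** With l g = diag(a) q by [cartan] and q0 the limit of q, let u = q0 v. If the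
    minor of u at s is nonzero, the weight A s = prod_j a^(s j) is in the ideal.
    Choose s with A s largest and let f be the basis of the span of u dual to the
    coefficients at the s i. If f i has a monomial c, exchanging s i for c gives
    another nonzero minor of u, hence a^c is at most as large as a^(s i). The
    semistable h cannot tend to 0 under diag(a) q, so that for some i0 the weight
    a^(s i0) does not tend to 0. Removing f i0 divides A s by this weight, so that
    it remains in the ideal, and it bounds all minors of the other f i. *)
Theorem exists_hyperplane b k (g : T -> 'M[F]_n.+1) (v : k.+1.-tuple forms) (h : forms) :
  (forall t, \det (g t) = 1) -> free v -> h \in <<v>>%VS ->
  git_semistable (@form_act F n d) h ->
  (forall t', small p b (fun t => wedge (act_tuple (g t) v) t')) ->
  exists (a : T -> 'rV[F]_n.+1) (q : 'M[F]_n.+1) (y : k.-tuple forms),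
  [/\ (forall t, \prod_i a t 0 i = 1) /\ \det q = 1,
      free y /\ (<<y>> <= <<v>>)%VS,
      forall t', small p b (fun t => wedge (act_tuple (diag_mx (a t) *m q) y) t')
    & (forall i, bounded p (fun t => a t 0 i)) ->
      forall i j, bounded p (fun t => g t i j)].
Proof.
move=> g1 vfree hv hss sg.
have [a [l [q [l0 [q0 [a1 [ll l01] [lq q01] aq]]]]]] := cartan p g1.
have a_neq0 t i : a t 0 i != 0.
  apply/eqP => ai; have := a1 t; rewrite (bigD1 i) //= ai mul0r.
  by move/eqP; rewrite eq_sym oner_eq0.
have torus_mon_neq0 t (c : 'X_{1..n.+1}) : torus_mon (a t) c != 0.
  by apply/prodf_neq0 => i _; rewrite expf_neq0.
pose A (s : {ffun 'I_k.+1 -> mon}) t := \prod_j torus_mon (a t) (s j).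
pose u := act_tuple q0 v.
have q0u : q0 \in unitmx by rewrite unitmxE q01 unitr1.
have smallA s : minor s u != 0 -> small p b (A s).
  move=> su.
  have sAq : small p b (fun t => A s t * minor s (act_tuple (q t) v)).
    have /small_minor/(_ s) := small_act_bounded ll sg.
    apply: small_ae aq _ => t aqt.
    by rewrite act_tupleM -aqt -act_tupleM minor_diag.
  have lim_q := lim_minor_act v s lq.
  have bV : bounded p (fun t => (minor s (act_tuple (q t) v))^-1).
    by eexists; exact: limV lim_q su.
  have := smallM sAq bV.
  apply: small_ae (ae_neq0 lim_q su) _ => t qt.
  by rewrite mulfK.
have ufree : free u.
  apply/freeP => c cu i; move/freeP: vfree; apply.
  rewrite -(form_act1 (\sum_i _)) -(mulVmx q0u) -form_actM form_act_sum.
  rewrite -[RHS](linear0 (form_act (invmx q0))); congr (form_act _ _).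
  rewrite -[RHS]cu; apply: eq_bigr => j _.
  by rewrite -!tnth_nth tnth_mktuple.
have [s su smin] : exists2 s, minor s u != 0 &
    forall s', minor s' u != 0 -> vle p (A s') (A s).
  apply: (@exists_min _ (fun s s' => vle p (A s') (A s)) (fun s => minor s u != 0)).
  - by move=> s s'; exact: vle_total.
  - by move=> s s' s'' ss' s's''; apply: vle_trans s's'' ss'.
  - exact: exists_minor.
(* B turns u into the basis f, dual to the coefficients at the s i *)
pose M := \matrix_(i < k.+1, j < k.+1) fcoef (s j) (tnth u i).
have Mu : M \in unitmx by rewrite unitmxE unitfE.
pose B := invmx M.
pose f := [tuple \sum_j B i j *: tnth u j | i < k.+1].
have fE i : tnth f i = \sum_j B i j *: tnth u j by rewrite tnth_mktuple.
have cff i j : fcoef (s j) (tnth f i) = (i == j)%:R.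
  have := congr1 (fun X : 'M_k.+1 => X i j) (mulVmx Mu); rewrite !mxE => <-.
  by rewrite fE fcoef_sum; apply: eq_bigr => r _; rewrite mxE.
have detB : \det B != 0 by rewrite -unitfE -unitmxE unitmx_inv.
have exch i (c : mon) : fcoef c (tnth f i) != 0 ->
    vle p (fun t => torus_mon (a t) c) (fun t => torus_mon (a t) (s i)).
  move=> cfi.
  pose s' : {ffun 'I_k.+1 -> mon} := [ffun j => if j == i then c else s j].
  have s'i j : j != i -> s' j = s j by move=> /negPf ji; rewrite ffunE ji.
  (* the columns of this minor are those of the identity, but for column i, whose
     diagonal entry is the coefficient of f i at c *)
  have : minor s' f != 0.
    apply/det0P => [[w w0 wf]]; case/eqP: w0.
    have wE j : \sum_r w 0 r * fcoef (s' j) (tnth f r) = 0.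
      have /rowP/(_ j) := wf; rewrite !mxE => w0; rewrite -[RHS]w0.
      by apply: eq_bigr => r _; rewrite mxE.
    have wj j : j != i -> w 0 j = 0.
      move=> ji; have := wE j; rewrite s'i // (bigD1 j) //= cff eqxx mulr1 big1 ?addr0 //.
      by move=> r /negPf rj; rewrite cff rj mulr0.
    apply/rowP => j; rewrite mxE; have [->|/wj//] := eqVneq j i.
    have := wE i; rewrite (bigD1 i) //= big1 ?addr0 => [|r /wj ->]; last by rewrite mul0r.
    by rewrite ffunE eqxx => /eqP; rewrite mulf_eq0 (negPf cfi) orbF => /eqP.
  rewrite (minor_comb s' fE) mulf_eq0 (negPf detB) /= => /smin [e be As'].
  exists e => //; apply: aeW As' => t.
  rewrite /A (bigD1 i) //= [X in _ = _ * X](bigD1 i) //= ffunE eqxx.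
  under eq_bigr => j ji do rewrite s'i //.
  rewrite mulrA; apply: mulIf.
  by apply/prodf_neq0 => j _.
have [i0 si0] : exists i0, ~ p (fun t => torus_mon (a t) (s i0), 0).
  apply: contrapT => /forallNP H.
  have {}H i : p (fun t => torus_mon (a t) (s i), 0) by apply: contrapT; exact: H.
  (* otherwise diag(a) q h tends to 0 *)
  apply: hss.
  have hE : exists c : 'I_k.+1 -> F, form_act q0 h = \sum_i c i *: tnth f i.
    pose r : 'rV_k.+1 := \row_i coord v i h.
    exists ((r *m M) 0).
    under [RHS]eq_bigr do rewrite fE.
    rewrite lin_comb {1}(coord_span hv) form_act_sum; apply: eq_bigr => j _.
    have /rowP/(_ j) : r *m M *m B = r by rewrite mulmxK.
    by rewrite [in X in _ = X -> _]mxE mxE => <-; rewrite -tnth_nth tnth_mktuple.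
  have [c hc] := hE.
  apply: (lim_closure (u := fun t => form_act (diag_mx (a t) *m q0) h)).
    move=> t; exists (diag_mx (a t) *m q0) => //.
    by rewrite /SL det_mulmx det_diag a1 q01 mulr1.
  move=> i; rewrite linear0.
  have lin : linear_for *%R (coord (vbasis {:forms}) i : forms -> F).
    by move=> z x w; rewrite linearP.
  under eq_fun do rewrite (linear_fcoef _ lin).
  have zm : \sum_(m : mon) (0 : F) = 0 by rewrite big1.
  rewrite -[X in p (_, X)]zm.
  apply: sub_sum => // m; apply: lim0M; last exact: bounded_cst.
  under eq_fun do rewrite -form_actM fcoef_diag hc fcoef_sum mulr_sumr.
  have zk : \sum_(j < k.+1) (0 : F) = 0 by rewrite big1.
  rewrite -[X in p (_, X)]zk.
  apply: sub_sum => // j; under eq_fun do rewrite mulrCA.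
  have [cm|cm] := eqVneq (fcoef m (tnth f j)) 0.
    by rewrite cm; under eq_fun do rewrite mulr0 mulr0; exact: (sub_cst sp).
  under eq_fun do rewrite mulrC -mulrA.
  by apply: lim0M; [exact: vle_lim0 (exch _ _ cm) (H j) | exact: bounded_cst].
pose y := [tuple \sum_j B (lift i0 i) j *: tnth v j | i < k].
exists a, q0, y; split=> //.
- split.
    apply/freeP => c cy.
    have cB : forall j, \sum_i c i * B (lift i0 i) j = 0.
      move/freeP: (vfree) => /(_ (fun j => \sum_i c i * B (lift i0 i) j)); apply.
      rewrite -[RHS]cy; under [RHS]eq_bigr do rewrite -tnth_nth tnth_mktuple.
      by rewrite lin_comb; apply: eq_bigr => i _; rewrite -tnth_nth.
    pose r : 'rV_k := \row_i c i.
    have rB : r *m row' i0 B = 0.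
      apply/rowP => j; rewrite !mxE -[RHS](cB j).
      by apply: eq_bigr => i _; rewrite !mxE.
    have BM : row' i0 B *m M = row' i0 1%:M.
      rewrite -(mulVmx Mu); apply/matrixP => i j; rewrite !mxE.
      by apply: eq_bigr => l' _; rewrite mxE.
    move=> i; have /rowP/(_ (lift i0 i)) : r *m row' i0 1%:M = 0.
      by rewrite -BM mulmxA rB mul0mx.
    rewrite !mxE (bigD1 i) //= !mxE eqxx mulr1 big1 ?addr0 // => j ji.
    by rewrite !mxE (inj_eq (@lift_inj _ _)) (negPf ji) mulr0.
  apply/span_subvP => w /tnthP [i ->]; rewrite tnth_mktuple.
  by apply: rpred_sum => j _; apply/rpredZ/memv_span/mem_tnth.
- apply/small_minor => s'.
  have yE i : form_act q0 (tnth y i) = tnth f (lift i0 i).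
    rewrite fE tnth_mktuple form_act_sum; apply: eq_bigr => j _.
    by rewrite tnth_mktuple.
  (* row i is a multiple e of the weight of s (lift i0 i), the product of these
     weights being A s divided by the weight of s i0 *)
  have /boolp.choice [e eP] : forall x : 'I_k * 'I_k, exists e : T -> F, bounded p e /\
      ae p (fun t => torus_mon (a t) (s' x.2) * fcoef (s' x.2) (tnth f (lift i0 x.1)) =
                     torus_mon (a t) (s (lift i0 x.1)) * e t).
    move=> [i j] /=; set c := fcoef _ _; have [->|c0] := eqVneq c 0.
      exists (fun=> 0); split; first exact: bounded_cst.
      by apply: aeT => t; rewrite !mulr0.
    have [e be eE] := exch _ _ c0; exists (fun t => e t * c); split.
      by apply: boundedM => //; exact: bounded_cst.
    by apply: aeW eE => t ->; ring.
  pose E t := \matrix_(i < k, j < k) e (i, j) t.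
  have [|E0 limE] := @bounded_limx _ _ E.
    by move=> i j; under eq_fun do rewrite mxE; case: (eP (i, j)).
  have bE : bounded p (fun t => \det (E t)) by eexists; exact: limx_det limE.
  have sAE := smallM (smallM (smallA _ su) (boundedV si0)) bE.
  apply: small_ae (ae_forall (fun x => (eP x).2)) _ sAE => t eE.
  rewrite -act_tupleM minor_diag /A (bigD1_ord i0) //= [X in X / _ * _]mulrC mulfK //.
  have -> : \prod_i torus_mon (a t) (s (lift i0 i)) =
      \det (diag_mx (\row_i torus_mon (a t) (s (lift i0 i)))).
    by rewrite det_diag; apply: eq_bigr => i _; rewrite mxE.
  rewrite -minor_diag act_tupleM -det_mulmx /minor; congr (\det _).
  apply/matrixP => i j; rewrite mul_diag_mx !mxE tnth_mktuple -form_actM fcoef_diag yE.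
  exact: esym (eE (i, j)).
- move=> ba.
  have [|D limD] := @bounded_limx _ _ (fun t => diag_mx (a t)).
    move=> i j; under eq_fun do rewrite mxE.
    by case: (i == j); [exact: ba | exact: (bounded_cst p 0)].
  have l0_neq0 : \det l0 != 0 by rewrite l01 oner_neq0.
  have lim_g := limxM (limx_inv ll l0_neq0) (limxM limD lq).
  move=> i j; eexists; apply: lim_ae (aeI aq (ae_neq0 (limx_det ll) l0_neq0)) _ (lim_g i j).
  by move=> t [-> lt]; rewrite mulKmx // unitmxE unitfE.
Qed.
End Hyperplane.

(** * Unbounded torus points *)

Lemma common_denominator (I : finType) (x : I -> rat) :
  exists (D : nat) (z : I -> int), (0 < D)%N /\ forall i, D%:R * x i = (z i)%:~R.
Proof.
have H (s : seq I) : exists (D : nat) (z : I -> int), (0 < D)%N /\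
    forall i, i \in s -> D%:R * x i = (z i)%:~R.
  elim: s => [|j s [D [z [D0 Dz]]]]; first by exists 1%N, (fun=> 0).
  exists (`|denq (x j)| * D)%N.
  exists (fun i => if i \in s then denq (x j) * z i else D%:Z * numq (x j)).
  split; first by rewrite muln_gt0 D0 absz_gt0 denq_neq0.
  have dE : (`|denq (x j)|%N%:R : rat) = (denq (x j))%:~R.
    by rewrite -[in RHS](gez0_abs (ltW (denq_gt0 (x j)))).
  move=> i; rewrite inE natrM dE; case: ifP => [si _|_ /orP[/eqP->|//]].
    by rewrite -mulrA Dz // -intrM.
  by rewrite intrM numqE -pmulrn; ring.
have [D [z [D0 Dz]]] := H (enum I).
by exists D, z; split=> // i; apply: Dz; exact: mem_enum.
Qed.

Section Torus.
Variables (T : Type) (F : fieldType) (p : place T F) (N : nat).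
Variable a : T -> 'rV[F]_N.
Hypothesis a_neq0 : forall t i, a t 0 i != 0.
Let sp := place_sub p.

Definition tchar (x : 'rV[F]_N) (w : 'I_N -> int) := \prod_j x 0 j ^ w j.

(** The characters with value at a a unit of the valuation ring; they form a
    subgroup of the character lattice. *)
Definition unit_char w := exists2 c, c != 0 & p (fun t => tchar (a t) w, c).

Lemma unit_charD w w' : unit_char w -> unit_char w' ->
  unit_char (fun j => w j + w' j).
Proof.
move=> [c c0 pc] [c' c0' pc']; exists (c * c'); first exact: mulf_neq0.
have := subM sp pc pc'; congr (p (_, _)); apply: funext => t.
by rewrite /tchar -big_split; apply: eq_bigr => j _; rewrite /= expfzDr.
Qed.

Lemma unit_charN w : unit_char w -> unit_char (fun j => - w j).
Proof.
move=> [c c0 pc]; exists c^-1; first by rewrite invr_eq0.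
have := limV pc c0; congr (p (_, _)); apply: funext => t.
by rewrite /tchar -prodfV; apply: eq_bigr => j _; rewrite invr_expz.
Qed.

Lemma unit_char0 : unit_char (fun=> 0).
Proof.
exists 1; first exact: oner_neq0.
have := sub_cst sp 1; congr (p (_, _)); apply: funext => t.
by rewrite /tchar big1.
Qed.

Lemma unit_charM (z : int) w : unit_char w -> unit_char (fun j => z * w j).
Proof.
move=> uw.
have H (k : nat) : unit_char (fun j => k%:Z * w j).
  elim: k => [|k IH].
    by under eq_fun do rewrite mul0r; exact: unit_char0.
  by under eq_fun do rewrite intS mulrDl mul1r; exact: unit_charD.
case: z => k; first exact: H.
by under eq_fun do rewrite NegzE mulNr; exact/unit_charN/H.
Qed.

Lemma unit_char_sum (I : Type) (r : seq I) (z : I -> int) (w : I -> 'I_N -> int) :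
  (forall i, unit_char (w i)) -> unit_char (fun j => \sum_(i <- r) z i * w i j).
Proof.
move=> uw; elim: r => [|i r IH].
  by under eq_fun do rewrite big_nil; exact: unit_char0.
under eq_fun do rewrite big_cons.
exact/unit_charD/IH/unit_charM.
Qed.

Lemma unit_char_bounded i (D : nat) : (0 < D)%N ->
  unit_char (fun j => D%:Z *+ (j == i)) -> bounded p (fun t => a t 0 i).
Proof.
move=> D0 [c c0 pc]; have [//|lim0] := lim_total p (fun t => a t 0 i).
have pc' : p (fun t => a t 0 i ^+ D, c).
  have := pc; congr (p (_, _)); apply: funext => t.
  rewrite /tchar (bigD1 i) //= eqxx mulr1n big1 ?mulr1 // => j /negPf ->.
  by rewrite mulr0n expr0z.
have : p (fun t => (a t 0 i)^-1 ^+ D, 0).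
  case: D D0 {pc pc'} => // D _; under eq_fun do rewrite exprS.
  rewrite -(mul0r (0 ^+ D : F)); apply: (subM sp) => //.
  elim: D => [|D IH]; first by under eq_fun do rewrite expr0; exact: (sub_cst sp).
  by rewrite exprS; under eq_fun do rewrite exprS; exact: (subM sp).
under eq_fun do rewrite exprVn.
move=> /(lim_uniq (limV pc' c0)) /eqP; rewrite invr_eq0 => c00.
by rewrite c00 in c0.
Qed.

(** If the unit characters w had full rank, they would span a multiple of each
    coordinate character, and all coordinates of a would be bounded. Hence linear
    algebra over the rationals provides a one-parameter subgroup r that is
    trivial on them. *)
Lemma unit_char_orthogonal (I : finType) (w : I -> 'I_N -> int) :
  (forall i, unit_char (w i)) -> ~ (forall j, bounded p (fun t => a t 0 j)) ->
  exists2 r : 'I_N -> int, exists j, r j != 0 & forall i, \sum_j w i j * r j = 0.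
Proof.
move=> uw nb; pose M := \matrix_(i < #|I|, j < N) (w (enum_val i) j)%:~R : 'M[rat]_(_, _).
have [Mfull|Mnfull] := boolP (row_full M).
  case: nb => j; have /row_fullP [X XM] := Mfull.
  have [D [z [D0 Dz]]] := common_denominator (X j).
  apply: (@unit_char_bounded _ D D0).
  have := unit_char_sum (index_enum 'I_#|I|) z (fun i => uw (enum_val i)).
  congr unit_char; apply: funext => l; apply: (@intr_inj rat).
  rewrite raddf_sum /=; under eq_bigr do rewrite intrM -Dz -mulrA.
  rewrite -mulr_sumr; have /matrixP/(_ j l) := XM; rewrite !mxE.
  under eq_bigr do rewrite mxE.
  move=> ->; rewrite (eq_sym l); case: (j == l).
    by rewrite !mulr1n mulr1.
  by rewrite !mulr0n mulr0.
have [i0 [j0 c0]] : exists i j, cokermx M i j != 0.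
  apply: contrapT => H; case/negP: Mnfull; rewrite -cokermx_eq0.
  apply/eqP/matrixP => i j; rewrite [RHS]mxE; apply/eqP; apply: contrapT => /negP c0.
  by apply: H; exists i, j.
have [D [r [D0 Dr]]] := common_denominator (fun i => cokermx M i j0).
have Dn0 : (D%:R : rat) != 0 by rewrite pnatr_eq0 -lt0n.
exists r; first by exists i0; rewrite -(intr_eq0 rat) -Dr mulf_neq0.
move=> i; apply: (@intr_inj rat); rewrite raddf_sum /=.
under eq_bigr do rewrite intrM -Dr mulrCA.
rewrite -mulr_sumr; have /matrixP/(_ (enum_rank i) j0) := mulmx_coker M.
rewrite mxE [in RHS]mxE; under eq_bigr do rewrite mxE enum_rankK.
by move=> ->; rewrite mulr0.
Qed.

End Torus.

(** * Places attached to closures and to infinite sets *)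

Section Places.
Variable F : closedFieldType.

(** Giving q(u) the limit q(w), for each polynomial q, is consistent: a
    polynomial that vanishes on the range of u vanishes at w. *)
Lemma place_of_closure (T : Type) (W : vectType F) (u : T -> W) (w : W) :
  zariski_closure (range u) w -> exists p : place T F, forall i,
    p (fun t => coord (vbasis {:W}) i (u t), coord (vbasis {:W}) i w).
Proof.
move=> uw.
pose A : set ((T -> F) * F) := range (fun q : {mpoly F[\dim {:W}]} =>
  (fun t => polyfun q (u t), polyfun q w)).
have [|[q _ [q0 q1]]|p Ap] := @place_exists _ _ A.
- split=> [c|f g a b|f g a b].
  + exists c%:MP => //; rewrite /polyfun mevalC; congr (_, _).
    by apply: funext => t; rewrite mevalC.
  + move=> [q _ [<- <-]] [q' _ [<- <-]]; exists (q + q') => //.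
    rewrite /polyfun mevalD; congr (_, _).
    by apply: funext => t; rewrite mevalD.
  + move=> [q _ [<- <-]] [q' _ [<- <-]]; exists (q * q') => //.
    rewrite /polyfun mevalM; congr (_, _).
    by apply: funext => t; rewrite mevalM.
- have := uw q; rewrite q1 => /(_ _)/eqP; rewrite oner_eq0 => H.
  have {}H : false by apply: H => _ [t _ <-]; rewrite -[LHS]/((fun t => polyfun q (u t)) t) q0.
  by [].
exists p => i; apply: Ap; exists 'X_i => //; rewrite /polyfun mevalXU.
by congr (_, _); apply: funext => t; rewrite mevalXU.
Qed.

(** Giving 1/f the limit 0 is consistent: a polynomial relation satisfied by
    1/f is trivial since 1/f takes infinitely many values. *)
Lemma place_of_infinite (T : Type) (f : T -> F) : infinite_set (range f) ->
  exists p : place T F, ~ bounded p f.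
Proof.
move=> finf.
pose A : set ((T -> F) * F) := fun x => exists q : {poly F},
  x.2 = q.[0] /\ forall t, f t != 0 -> x.1 t = q.[(f t)^-1].
have [|[q [q0 qf]]|p Ap] := @place_exists _ _ A.
- split=> [c|g g' a b|g g' a b].
  + by exists c%:P; rewrite hornerC; split=> // t _; rewrite hornerC.
  + move=> [q [/= -> qg]] [q' [/= -> qg']]; exists (q + q'); rewrite hornerD.
    by split=> // t ft; rewrite hornerD /= qg // qg'.
  + move=> [q [/= -> qg]] [q' [/= -> qg']]; exists (q * q'); rewrite hornerM.
    by split=> // t ft; rewrite hornerM /= qg // qg'.
- apply: finf.
  have q_neq0 : q != 0.
    by apply/eqP => qz; move: q0; rewrite qz horner0 /= => /eqP; rewrite oner_eq0.
  have [r qr] := closed_field_poly_normal q.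
  apply: (@sub_finite_set _ _ [set` 0 :: [seq x^-1 | x <- r]]); last exact: finite_seq.
  move=> _ [t _ <-]; rewrite /= inE; have [//|ft] := eqVneq (f t) 0.
  have : root q (f t)^-1 by rewrite /root -qf.
  rewrite qr rootZ ?lead_coef_eq0 // root_prod_XsubC => fr.
  by rewrite -[f t]invrK map_f.
exists p => [[c pc]].
have pV : p (fun t => (f t)^-1, 0).
  by apply: Ap; exists 'X; rewrite hornerX; split=> // t _; rewrite hornerX.
have p1 : p (fun t => if f t == 0 then 0 else 1, 1).
  by apply: Ap; exists 1; rewrite hornerC; split=> // t /negPf ft; rewrite hornerC /= ft.
have := subM (place_sub p) pc pV; rewrite mulr0.
have -> : (fun t => f t * (f t)^-1) = (fun t => if f t == 0 then 0 else 1).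
  by apply: funext => t; case: eqP => [->|/eqP ft]; [rewrite mul0r | rewrite divff].
by move=> /(lim_uniq p1) /eqP; rewrite oner_eq0.
Qed.

Lemma infinite_entry m (Z : set 'M[F]_m) : infinite_set Z ->
  exists i j, infinite_set [set A i j | A in Z].
Proof.
move=> Zinf; apply: contrapT => H; apply: Zinf.
have {}H i j : finite_set [set A i j | A in Z].
  by apply: contrapT => nf; apply: H; exists i, j.
have /boolp.choice [s sE] : forall x : 'I_m * 'I_m, exists s : seq F,
    [set A x.1 x.2 | A in Z]%classic = [set` s]%classic.
  by move=> x; apply/finite_seqP; exact: H.
pose r := flatten [seq s x | x <- enum {: 'I_m * 'I_m}].
pose X (h : {ffun 'I_m * 'I_m -> 'I_(size r)}) := \matrix_(i, j) r`_(h (i, j)).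
apply: (@sub_finite_set _ _ [set X h | h in setT]); last exact/finite_image/finite_finset.
move=> A ZA.
have Ar x : A x.1 x.2 \in r.
  apply/flattenP; exists (s x); first by apply: map_f; exact: mem_enum.
  have : [set A x.1 x.2 | A in Z]%classic (A x.1 x.2) by exists A.
  by rewrite sE.
have lt x : (index (A x.1 x.2) r < size r)%N by rewrite index_mem.
exists [ffun x => Ordinal (lt x)] => //.
by apply/matrixP => i j; rewrite mxE ffunE /= nth_index // (Ar (i, j)).
Qed.

End Places.

Section Limits.
Variables (T : Type) (F : fieldType) (p : place T F) (n d : nat).
Notation forms := (forms F n d).
Let sp := place_sub p.

Lemma lim_extpow_of_coord m (u : T -> extpow forms m) (w : extpow forms m) :
  (forall i, p (fun t => coord (vbasis {:extpow forms m}) i (u t),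
               coord (vbasis {:extpow forms m}) i w)) ->
  forall t', p (fun t => u t t', w t').
Proof.
move=> lu t'.
have cE (x : extpow forms m) : x t' = \sum_i coord (vbasis {:extpow forms m}) i x *
    (vbasis {:extpow forms m})`_i t'.
  by rewrite {1}(coord_vbasis (memvf x)) sum_ffunE; apply: eq_bigr => i _; rewrite ffunE.
rewrite cE; under eq_fun do rewrite cE.
by apply: (sub_sum _ sp) => i; apply: (subM sp) => //; exact: (sub_cst sp).
Qed.

Lemma lim_wedge_act m (k : T -> 'M[F]_n.+1) k0 (v : m.-tuple forms) t' :
  limx p k k0 -> p (fun t => wedge (act_tuple (k t) v) t', wedge (act_tuple k0 v) t').
Proof.
move=> lk; rewrite ffunE; under eq_fun do rewrite ffunE.
apply: limx_det => i j; rewrite mxE tnth_mktuple.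
under eq_fun do rewrite mxE tnth_mktuple.
apply: (@lim_form_act _ _ p n d _ _ _ (coord (vbasis {:forms}) (tnth (val t') j))) => //.
by move=> c x y; rewrite linearP.
Qed.

Lemma small_subspace b k m (g : T -> 'M[F]_n.+1) (y : k.-tuple forms) (z : m.-tuple forms) :
  m = k -> (forall i, tnth z i \in <<y>>%VS) ->
  (forall t', small p b (fun t => wedge (act_tuple (g t) y) t')) ->
  forall t', small p b (fun t => wedge (act_tuple (g t) z) t').
Proof.
move=> mk; subst m => zy /small_minor sy; apply/small_minor => s.
pose P := \matrix_(i < k, j < k) coord y j (tnth z i).
have zE t i : tnth (act_tuple (g t) z) i = \sum_j P i j *: tnth (act_tuple (g t) y) j.
  rewrite tnth_mktuple (coord_span (zy i)) form_act_sum; apply: eq_bigr => j _.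
  by rewrite tnth_mktuple mxE [tnth y j](tnth_nth 0).
under eq_fun do rewrite (minor_comb s (zE _)) mulrC.
by apply: smallM => //; exact: bounded_cst.
Qed.

End Limits.

(** * Stability of subsystems *)

Section Stability.
Variables (F : numClosedFieldType) (n d : nat).
Notation forms := (forms F n d).
Notation mon := 'X_{1..n.+1 < d.+1}.

Lemma unstable_of_lim0 T (p : place T F) m (g : T -> 'M[F]_n.+1) (v : m.-tuple forms) :
  (forall t, \det (g t) = 1) ->
  (forall t', p (fun t => wedge (act_tuple (g t) v) t', 0)) ->
  git_unstable (@plucker_act F n d m) (wedge v).
Proof.
move=> g1 lg; apply.
apply: (lim_closure (u := fun t => plucker_act (g t) (wedge v))).
  by move=> t; exists (g t); first exact: g1.
apply: lim_coord_of_extpow => t'; rewrite ffunE.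
by under eq_fun do rewrite plucker_act_wedge.
Qed.

(** Were the orbit closed with a finite stabilizer, the limit of diag(a) q z
    would be g1 z for some g1. Its nonzero minors have weights at which a is a
    unit, so that an entire one-parameter subgroup lam fixes it; conjugation by
    g1 sends lam into the stabilizer of z. *)
Lemma nonstable_of_bounded T (p : place T F) m (a : T -> 'rV[F]_n.+1) (q : 'M[F]_n.+1)
    (z : m.-tuple forms) :
  (forall t, \prod_i a t 0 i = 1) -> \det q = 1 ->
  (forall t', bounded p (fun t => wedge (act_tuple (diag_mx (a t) *m q) z) t')) ->
  ~ (forall i, bounded p (fun t => a t 0 i)) ->
  git_nonstable (@plucker_act F n d m) (wedge z).
Proof.
move=> a1 q1 bz nb [ss clo fin].
have a_neq0 t i : a t 0 i != 0.
  apply/eqP => ai; have := a1 t; rewrite (bigD1 i) //= ai mul0r.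
  by move/eqP; rewrite eq_sym oner_eq0.
have /boolp.choice [w0 w0P] := bz.
pose w : extpow forms m := finfun w0.
have lw t' : p (fun t => wedge (act_tuple (diag_mx (a t) *m q) z) t', w t').
  by rewrite ffunE.
have [g1 Sg1 wE] : SLorbit (@plucker_act F n d m) (wedge z) w.
  apply: clo.
  apply: (lim_closure (u := fun t => plucker_act (diag_mx (a t) *m q) (wedge z))).
    move=> t; exists (diag_mx (a t) *m q) => //.
    by rewrite /SL det_mulmx det_diag a1 q1 mulr1.
  by apply: lim_coord_of_extpow => t'; under eq_fun do rewrite plucker_act_wedge.
rewrite plucker_act_wedge in wE; pose x := act_tuple g1 z.
have mx (s : {ffun 'I_m -> mon}) :
    p (fun t => (\prod_j torus_mon (a t) (s j)) * minor s (act_tuple q z), minor s x).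
  under eq_fun do rewrite -minor_diag act_tupleM.
  have [c cE] := minor_wedge F s; rewrite cE; under eq_fun do rewrite cE.
  apply: sub_sum => [|t']; first exact: place_sub.
  by apply: (subM (place_sub p)); [rewrite -wE | exact: (sub_cst (place_sub p))].
pose chi (s : {ffun 'I_m -> mon}) i : int := (\sum_j s j i)%N%:Z.
have chiE (y : 'rV[F]_n.+1) (s : {ffun 'I_m -> mon}) : \prod_j torus_mon y (s j) = tchar y (chi s).
  rewrite exchange_big; apply: eq_bigr => i _.
  by rewrite /chi -exprnP expr_sum.
(* None stands for the determinant, so that lam below has determinant 1 *)
pose wt (o : option {ffun 'I_m -> mon}) : 'I_n.+1 -> int :=
  if o is Some s then if minor s x == 0 then fun=> 0 else chi s else fun=> 1.
have uwt o : unit_char p a (wt o).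
  case: o => [s|] /=; last first.
    exists 1; first exact: oner_neq0.
    have := sub_cst (place_sub p) 1; congr (p (_, _)); apply: funext => t.
    by rewrite /tchar -[LHS](a1 t); apply: eq_bigr => i _; rewrite expr1z.
  have [_|xs] := eqVneq (minor s x) 0; first exact: unit_char0.
  have := mx s; under eq_fun do rewrite chiE.
  set c := minor s (act_tuple q z) => lc.
  have c0 : c != 0.
    apply/eqP => cz; case/eqP: xs; apply: lim_uniq lc _.
    by under eq_fun do rewrite cz mulr0; exact: (sub_cst (place_sub p)).
  exists (minor s x / c); first by rewrite mulf_neq0 // invr_eq0.
  have := subM (place_sub p) lc (sub_cst (place_sub p) c^-1).
  by under eq_fun do rewrite mulfK //.
have [r [j rj] rwt] := unit_char_orthogonal a_neq0 uwt nb.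
pose lam (e : nat) : 'rV[F]_n.+1 := \row_i (2 ^ (e%:Z * r i)).
have two0 : (2 : F) != 0 by rewrite pnatr_eq0.
have lamE e o : tchar (lam e) (wt o) = 1.
  transitivity ((2 : F) ^ (\sum_i e%:Z * (wt o i * r i))).
    rewrite (big_morph _ (fun x y => expfzDr x y two0) (expr0z 2)).
    by apply: eq_bigr => i _; rewrite mxE exprz_exp; congr (_ ^ _); ring.
  by rewrite -mulr_sumr rwt mulr0 expr0z.
have lam1 e : \det (diag_mx (lam e)) = 1.
  by rewrite det_diag -[RHS](lamE e None); apply: eq_bigr => i _; rewrite expr1z.
have lamx e : wedge (act_tuple (diag_mx (lam e)) x) = wedge x.
  apply: wedge_eq => s; rewrite minor_diag chiE.
  have := lamE e (Some s); rewrite /=; have [->|_ ->] := eqVneq (minor s x) 0.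
    by rewrite mulr0.
  by rewrite mul1r.
have g1u : g1 \in unitmx by rewrite unitmxE Sg1 unitr1.
pose st e := invmx g1 *m diag_mx (lam e) *m g1.
have stab e : SLstabilizer (@plucker_act F n d m) (wedge z) (st e).
  split.
    by rewrite /SL !det_mulmx lam1 mulr1 det_inv Sg1 invr1 mulr1.
  rewrite plucker_act_wedge -!act_tupleM -plucker_act_wedge lamx plucker_act_wedge.
  by rewrite act_tupleM mulVmx // act_tuple1.
have st_inj : injective st.
  move=> e e' /(congr1 (fun X => g1 *m X *m invmx g1)).
  rewrite /st !mulmxA mulmxV // !mul1mx !mulmxK // => /matrixP /(_ j j).
  rewrite !mxE eqxx !mulr1n.
  pose two : rat := 2%:R.
  have ratE y : (2 : F) ^ y = ratr (two ^ y) by rewrite [RHS]fmorphXz /= [ratr two]ratr_nat.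
  rewrite !ratE => /fmorph_inj /(@ieexprIz _ two isT isT) /(mulIf rj) H.
  by case: H.
apply: infinite_nat.
have -> : [set: nat]%classic = (st @^-1` SLstabilizer (@plucker_act F n d m) (wedge z))%classic.
  by apply/seteqP; split=> // e _; exact: stab.
by apply: finite_preimage fin => e e' _ _; exact: st_inj.
Qed.

(** If L is non-stable without being unstable, either its orbit is not closed,
    and then a matrix g moving it towards a point outside its orbit is unbounded,
    or its stabilizer is infinite, and then it contains an unbounded g. *)
Theorem exists_subsystem k (L : {vspace forms}) (h : forms) : \dim L = k.+1 ->
  h \in L -> git_semistable (@form_act F n d) h ->
  (system_unstable L -> exists L' : {vspace forms},
    [/\ (L' <= L)%VS, \dim L' = k & system_unstable L']) /\
  (system_nonstable L -> exists L' : {vspace forms},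
    [/\ (L' <= L)%VS, \dim L' = k & system_nonstable L']).
Proof.
move=> dL hL hss.
have [v vL] : exists v : k.+1.-tuple forms, val v = vbasis L :> seq _.
  by rewrite -dL; exists (vbasis L).
have basv : basis_of L v by rewrite vL vbasisP.
have vfree := basis_free basv; have spv := span_basis basv.
have sys (Q : forall m, m.-tuple forms -> Prop) : Q _ (vbasis L) -> Q _ v.
  move: (vbasis L) vL; rewrite dL => w vw; have -> : v = w by exact: val_inj.
  by [].
have step b T (p : place T F) (g : T -> 'M[F]_n.+1) : (forall t, \det (g t) = 1) ->
    (forall t', small p b (fun t => wedge (act_tuple (g t) v) t')) ->
    exists (L' : {vspace forms}) (a : T -> 'rV[F]_n.+1) (q : 'M[F]_n.+1),
    [/\ (L' <= L)%VS, \dim L' = k,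
      (forall t, \prod_i a t 0 i = 1) /\ \det q = 1,
      forall t', small p b (fun t => wedge (act_tuple (diag_mx (a t) *m q) (vbasis L')) t')
    & (forall i, bounded p (fun t => a t 0 i)) ->
      forall i j, bounded p (fun t => g t i j)].
  move=> g1 sg; have hv : h \in <<v>>%VS by rewrite spv.
  have [a [q [y [aq [yfree yv] sy by_]]]] := exists_hyperplane g1 vfree hv hss sg.
  have dy : \dim <<y>> = k by rewrite (eqP yfree) size_tuple.
  exists <<y>>%VS, a, q; split=> //; first by rewrite -spv.
  apply: small_subspace sy => // i.
  exact/vbasis_mem/mem_tnth.
pose T := {g : 'M[F]_n.+1 | \det g = 1}.
have Uns : system_unstable L -> exists L' : {vspace forms},
    [/\ (L' <= L)%VS, \dim L' = k & system_unstable L'].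
  move/(sys (fun m v => git_unstable (@plucker_act F n d m) (wedge v))) => /contrapT clo.
  have [|p lp] := @place_of_closure F T _ (fun t => plucker_act (sval t) (wedge v)) 0.
    move=> q qA; apply: clo => _ [g Sg ->]; apply: qA.
    by exists (exist _ g Sg).
  have sg t' : small p true (fun t => wedge (act_tuple (sval t) v) t').
    have := lim_extpow_of_coord lp t'; rewrite ffunE.
    by under eq_fun do rewrite plucker_act_wedge.
  have [L' [a [q [L'L dL' [a1 q1] sL' _]]]] := step true T p sval (fun t => svalP t) sg.
  exists L'; split=> //; apply: unstable_of_lim0 sL' => t.
  by rewrite det_mulmx det_diag a1 q1 mulr1.
split=> // nst.
have [uL|ssL] := pselect (system_unstable L).
  have [L' [L'L dL' uL']] := Uns uL; exists L'; split=> //.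
  by case=> ss _ _; exact: uL'.
have {}ssL : git_semistable (@plucker_act F n d k.+1) (wedge v).
  by apply: (sys (fun m v => git_semistable (@plucker_act F n d m) (wedge v))); exact: contrapT.
have {}nst := sys (fun m v => git_nonstable (@plucker_act F n d m) (wedge v)) nst.
suff [T' [p [g [g1 sg nb]]]] : exists (T' : Type) (p : place T' F) (g : T' -> 'M[F]_n.+1),
    [/\ forall t, \det (g t) = 1,
     forall t', bounded p (fun t => wedge (act_tuple (g t) v) t')
     & ~ forall i j, bounded p (fun t => g t i j)].
  have [L' [a [q [L'L dL' [a1 q1] sL' ba]]]] := step false T' p g g1 sg.
  exists L'; split=> //; apply: (nonstable_of_bounded a1 q1 sL') => /ba.
  exact: nb.
have [clo|nclo] := pselect (zariski_closed (SLorbit (@plucker_act F n d k.+1) (wedge v))).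
  have inf : infinite_set (SLstabilizer (@plucker_act F n d k.+1) (wedge v)).
    by move=> fin; apply: nst.
  have [i [j ij_inf]] := infinite_entry inf.
  pose T' := {g : 'M[F]_n.+1 | SLstabilizer (@plucker_act F n d k.+1) (wedge v) g}.
  have [|p pij] := @place_of_infinite F T' (fun t => sval t i j).
    by apply: sub_infinite_set ij_inf => _ [g Sg <-]; exists (exist _ g Sg).
  exists T', p, sval; split; first by move=> [g [Sg gv]].
    move=> t'; exists (wedge v t').
    have -> : (fun t : T' => wedge (act_tuple (sval t) v) t') = fun=> wedge v t'.
      by apply: funext => -[g [Sg gv]] /=; rewrite -plucker_act_wedge gv.
    exact: (sub_cst (place_sub p)).
  by move=> H; apply: pij; exact: H.
have [w [wclo norb]] : exists w,
    zariski_closure (SLorbit (@plucker_act F n d k.+1) (wedge v)) w /\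
    ~ SLorbit (@plucker_act F n d k.+1) (wedge v) w.
  apply: contrapT => H; apply: nclo => w wclo; apply: contrapT => norb.
  by apply: H; exists w.
have [|p lp] := @place_of_closure F T _ (fun t => plucker_act (sval t) (wedge v)) w.
  move=> q qA; apply: wclo => _ [g Sg ->]; apply: qA.
  by exists (exist _ g Sg).
have lg t' : p (fun t : T => wedge (act_tuple (sval t) v) t', w t').
  by have := lim_extpow_of_coord lp t'; under eq_fun do rewrite plucker_act_wedge.
exists T, p, sval; split; first by move=> t; exact: svalP t.
  by move=> t'; exists (w t').
move=> bg; have [g0 lg0] := bounded_limx bg.
apply: norb; exists g0.
  have := limx_det lg0; rewrite /SL.
  have -> : (fun t : T => \det (sval t)) = fun=> 1 by apply: funext => t; exact: svalP t.
  by move=> /lim_uniq; apply; exact: (sub_cst (place_sub p)).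
rewrite plucker_act_wedge; apply/ffunP => t'.
exact: lim_uniq (lg t') (lim_wedge_act v t' lg0).
Qed.
End Stability.

Theorem theorem1p2 (R : realType) (n d k : nat) (L : {vspace forms R[i] n d}) :
  (1 < k)%N ->
  \dim L = k.+1 ->
  (exists f : forms R[i] n d,
     [/\ f \in L, f != 0 & hypersurface_semistable f]) ->
  (system_nonstable L ->
     exists L' : {vspace forms R[i] n d},
       [/\ (L' <= L)%VS, \dim L' = k & system_nonstable L']) /\
  (system_unstable L ->
     exists L' : {vspace forms R[i] n d},
       [/\ (L' <= L)%VS, \dim L' = k & system_unstable L']).
Proof.
move=> _ dL [f [fL _ fss]].
by have [unst nonst] := exists_subsystem dL fL fss; split.
Qed.
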